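(* Let $T$ be a power partial isometry on a Hilbert space $H$, and let $P$ and $Q$ be the orthogonal projections onto $\bigcap_{n=1}^\infty T^nH$ and $\bigcap_{n=1}^\infty T^{*n}H$ respectively. Then $PQ=QP$, and the subspaces $H_u:=PQH$, $H_s:=(1-P)QH$, $H_b:=(1-Q)PH$ and, for $p\geq 1$, \[ H_p:=\sum_{n=1}^p(T^{n-1}T^{*n-1}-T^{n}T^{*n})(T^{*p-n}T^{p-n}-T^{*p-n+1}T^{p-n+1})H \] are all reducing for $T$, and satisfy \[ H=H_u\oplus H_s\oplus H_b\oplus\Big(\bigoplus_{p=1}^\infty H_p\Big). \] Further, there are Hilbert spaces $M_s$, $M_b$ and $\{M_p:p\geq 1\}$ (any of which is allowed to be $\{0\}$) such that (1) $T|_{H_u}$ is unitary; (2) $T|_{H_s}$ is unitarily equivalent to $S\otimes 1$ on $\ell^2(\mathbb{N})\otimes M_s$; (3) $T|_{H_b}$ is unitarily equivalent to $S^*\otimes 1$ on $\ell^2(\mathbb{N})\otimes M_b$; (4) for $p\geq 1$, $T|_{H_p}$ is unitarily equivalent to $J_p\otimes 1$ on $\mathbb{C}^p\otimes M_p$.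
   Context: Hilbert spaces are complex, and operators are bounded and linear. A bounded operator $T$ on $H$ is a power partial isometry if $T^n$ is a partial isometry for all $n\geq 0$ (with $T^0=1$). Notation: $T^{*n}$ means $(T^* )^n$, and $T^{*n-m}$ means $(T^* )^{n-m}$ for $n\geq m$ (so, for example, $T^{*n-1}=(T^* )^{n-1}$ and $T^{*p-n+1}=(T^* )^{p-n+1}$). A closed subspace $K$ of $H$ is reducing for $T$ if $TK\subseteq K$ and $T^*K\subseteq K$. $S$ denotes the unilateral (forward) shift on $\ell^2=\ell^2(\mathbb{N})$, $Se_n=e_{n+1}$, and $S^*$ is its adjoint, the backward shift. For $p\geq 1$, the truncated shift $J_p$ on $\mathbb{C}^p$ is defined on the usual basis $e_1,\dots,e_p$ by $J_pe_n=e_{n+1}$ for $n<p$ and $J_pe_p=0$ (so $J_1=0$ on $\mathbb{C}$). Direct sums are orthogonal Hilbert space direct sums and tensor products are Hilbert space tensor products. *)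

(* Defs.v *)
From HB Require Import structures.
From mathcomp Require Import all_boot all_order all_algebra complex.
From mathcomp Require Import boolp classical_sets functions reals.
From mathcomp Require Import topology normedtype sequences.
From mathcomp Require Import ring lra.
Set Implicit Arguments.
Unset Strict Implicit.
Unset Printing Implicit Defensive.
Import Order.TTheory GRing.Theory Num.Theory Num.Def.
Import numFieldNormedType.Exports.
Local Open Scope classical_set_scope.
Local Open Scope ring_scope.
Local Open Scope complex_scope.

(* `hdot` is linear in its first argument and conjugate-linear in the second. *)
HB.mixin Record NormedModule_isHilbert (R : realType) V
    & NormedModule R[i] V := {
  hdot : {dot V for conjC} ;
  hdot_norm : forall x : V, `|x| ^+ 2 = hdot x x
}.

#[short(type="hilbertType")]
HB.structure Definition Hilbert (R : realType) :=
  {V of CompleteNormedModule R[i] V & NormedModule_isHilbert R V}.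

Section DotNorm.
Variables (R : realType) (V : lmodType R[i]) (f : {dot V for conjC}).

Definition dot_norm (x : V) : R[i] := sqrtC (f x x).

Lemma dot_CauchySchwarz u v : `|f u v| ^+ 2 <= f u u * f v v.
Proof.
have [-> | nz_v] := eqVneq v 0; first by rewrite !linear0r normr0 expr0n mulr0.
pose a := f u v / f v v; pose w := u - a *: v.
have wv : f w v = 0.
  by rewrite linearBl /= linearZl_LR /= divfK ?dnorm_eq0 ?subrr.
have -> : u = w + a *: v by rewrite subrK.
rewrite linearDl /= wv add0r linearZl_LR/= normrM (ger0_norm (dnorm_ge0 _ _)).
rewrite exprMn [X in _ <= X * _]hnormDd /=; last first.
  by rewrite linearZr_LR /= wv mulr0.
rewrite dnormZ expr2 mulrA ler_wpM2r ?dnorm_ge0 //.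
by rewrite lerDr dnorm_ge0.
Qed.

Lemma dot_norm_triangle x y : dot_norm (x + y) <= dot_norm x + dot_norm y.
Proof.
have n0 z : 0 <= dot_norm z by rewrite sqrtC_ge0 dnorm_ge0.
rewrite -(@ler_pXn2r _ 2) ?nnegrE ?addr_ge0 //.
rewrite sqrrD /dot_norm !sqrtCK dnormD [leRHS]addrAC lerD2l.
have cs : `|f x y| <= sqrtC (f x x) * sqrtC (f y y).
  rewrite -(@ler_pXn2r _ 2) ?nnegrE ?mulr_ge0 ?sqrtC_ge0 ?dnorm_ge0 //.
  by rewrite exprMn !sqrtCK dot_CauchySchwarz.
have re : f x y + conjC (f x y) <= `|f x y| *+ 2.
  apply: (le_trans (real_ler_norm _)).
    by rewrite CrealE rmorphD /= conjCK addrC.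
  by rewrite (le_trans (ler_normD _ _)) // norm_conjC mulr2n.
by rewrite (le_trans re) // lerMn2r.
Qed.

Lemma dot_normZ (a : R[i]) x : dot_norm (a *: x) = `|a| * dot_norm x.
Proof.
by rewrite /dot_norm dnormZ sqrtCM ?nnegrE ?exprn_ge0 ?dnorm_ge0 // sqrCK.
Qed.

Lemma dot_norm_eq0 x : dot_norm x = 0 -> x = 0.
Proof. by move/eqP; rewrite sqrtC_eq0 dnorm_eq0 => /eqP. Qed.

End DotNorm.

Definition sqmod (R : realType) (z : R[i]) : R := complex.Re (`|z| ^+ 2).

Section Sqmod.
Variable R : realType.
Implicit Types z w : R[i].

Lemma sqmodE z : sqmod z = complex.Re z ^+ 2 + complex.Im z ^+ 2.
Proof. by rewrite /sqmod normc_def -rmorphXn /= sqr_sqrtr ?addr_ge0 ?sqr_ge0. Qed.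

Lemma normc_sqmod z : `|z| ^+ 2 = (sqmod z)%:C.
Proof. by rewrite /sqmod RRe_real // realX. Qed.

Lemma sqmod_ge0 z : 0 <= sqmod z.
Proof. by rewrite sqmodE addr_ge0 ?sqr_ge0. Qed.

Lemma sqmod0 : sqmod (0 : R[i]) = 0.
Proof. by rewrite sqmodE /= expr0n addr0. Qed.

Lemma sqmod_eq0 z : sqmod z = 0 -> z = 0.
Proof.
case: z => a b; rewrite sqmodE /= => /eqP.
by rewrite paddr_eq0 ?sqr_ge0 // !sqrf_eq0 => /andP[/eqP-> /eqP->].
Qed.

Lemma sqmodD z w : sqmod (z + w) <= 2 * sqmod z + 2 * sqmod w.
Proof.
case: z w => [a b] [c d]; rewrite !sqmodE /= -subr_ge0.
rewrite (_ : _ - _ = (a - c) ^+ 2 + (b - d) ^+ 2) ?addr_ge0 ?sqr_ge0 //.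
by ring.
Qed.
End Sqmod.

Section CoordinateCompleteness.
Variables (R : realType) (V : normedModType R[i]).

Lemma cauchy_coord_cvg (F : set_system V) (phi : V -> R) :
  ProperFilter F -> cauchy F ->
  (forall x y, `|phi x - phi y|%:C <= `|x - y|) -> cvg (phi @ F).
Proof.
move=> FF Fc phiL; suff ce : cauchy_ex (phi @ F) by exact/cauchy_cvgP/(cauchy_exP _ ce).
move=> e e0.
have [|x Fx] := (cauchyP F).1 Fc e%:C; first by rewrite ltcR.
exists (phi x); apply: (@filterS _ F _ _ _ _ Fx) => y; rewrite -!ball_normE /= => xy.
by rewrite -ltcR; apply: le_lt_trans xy.
Qed.

Variables (I : Type) (c : I -> V -> R[i]).
Hypothesis cB : forall i x y, c i (x - y) = c i x - c i y.
Hypothesis c_inj : forall x y, (forall i, c i x = c i y) -> x = y.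
Variable fin : seq I -> Prop.
Hypothesis fin1 : forall i, fin [:: i].
Hypothesis c_le : forall s x, fin s ->
  (\sum_(i <- s) sqmod (c i x))%:C <= `|x| ^+ 2.
Hypothesis c_lift : forall (l : I -> R[i]) (g : V) (e : R), 0 < e ->
  (forall s, fin s -> \sum_(i <- s) sqmod (l i - c i g) <= e ^+ 2) ->
  exists2 w, (forall i, c i w = l i) & `|w - g| <= e%:C.

Lemma coord_complete (F : set_system V) : ProperFilter F -> cauchy F -> cvg F.
Proof.
move=> FF Fc.
have c1 i x : `|c i x| <= `|x|.
  rewrite -(@ler_pXn2r _ 2) ?nnegrE ?normr_ge0 // normc_sqmod.
  by have := c_le x (fin1 i); rewrite big_seq1.
have cRe i : cvg ((fun x => complex.Re (c i x)) @ F).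
  apply: cauchy_coord_cvg => // x y; rewrite -raddfB -cB.
  by rewrite (le_trans (normc_ge_Re _)).
have cIm i : cvg ((fun x => complex.Im (c i x)) @ F).
  apply: cauchy_coord_cvg => // x y; rewrite -raddfB -cB.
  apply: le_trans (c1 i _); rewrite normc_def lecR -sqrtr_sqr.
  by rewrite ler_wsqrtr // lerDr sqr_ge0.
pose l i : R[i] := lim ((fun x => complex.Re (c i x)) @ F)
  +i* lim ((fun x => complex.Im (c i x)) @ F).
have near_l (e : R) : 0 < e -> exists2 A, F A & forall g, A g ->
    forall s, fin s -> \sum_(i <- s) sqmod (l i - c i g) <= e ^+ 2.
  move=> e0; have [|x Fx] := (cauchyP F).1 Fc (e / 2)%:C.
    by rewrite ltcR divr_gt0.
  exists (ball x (e / 2)%:C) => // g xg s fs.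
  have cv : (fun f => \sum_(i <- s) sqmod (c i f - c i g)) @ F -->
      \sum_(i <- s) sqmod (l i - c i g).
    elim: s {fs} => [|i s IHs].
      rewrite big_nil; under eq_fun do rewrite big_nil; exact: cvg_cst.
    rewrite big_cons; under eq_fun do rewrite big_cons.
    apply: cvgD IHs; under eq_fun do rewrite sqmodE !raddfB.
    rewrite sqmodE !raddfB /=.
    by apply: cvgD; rewrite expr2; under eq_fun do rewrite expr2;
      apply: cvgM; apply: cvgB; rewrite ?cRe ?cIm //; apply: cvg_cst.
  apply: (@closed_cvg _ _ _ FF _ [set t | t <= e ^+ 2] _ _ _ cv).
    exact: closed_le.
  apply: filterS Fx => f xf /=.
  have fg : `|f - g| <= e%:C.
    have -> : f - g = (x - g) - (x - f) by rewrite opprB [RHS]addrC subrKA.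
    rewrite (le_trans (ler_normB _ _)) // [e in leRHS]splitr rmorphD /=.
    by move: xg xf; rewrite -!ball_normE /= => xg xf; rewrite lerD // ltW.
  rewrite -lecR rmorphXn /=; under eq_bigr do rewrite -cB.
  apply: (le_trans (c_le _ fs)).
  by rewrite ler_pXn2r ?nnegrE // lecR ltW.
have [A1 FA1 A1l] := near_l 1 ltr01.
have [g0 Ag0] := filter_ex FA1.
have [w wl _] := c_lift ltr01 (A1l _ Ag0).
apply/cvg_ex; exists w; apply/cvgrPdist_le => e e0.
have eR : e = (complex.Re e)%:C by rewrite RRe_real // gtr0_real.
have e0' : 0 < complex.Re e by rewrite -ltcR -eR.
have [A FA Al] := near_l _ e0'.
apply: filterS FA => g Ag.
have [w' wl' w'g] := c_lift e0' (Al _ Ag).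
have <- : w' = w by apply: c_inj => i; rewrite wl wl'.
by rewrite eR.
Qed.
End CoordinateCompleteness.

(* C^p with its Euclidean inner product. This is an alias because column
   vectors themselves already carry the supremum norm. *)
Definition Cvec (R : realType) (p : nat) : Type := 'cV[R[i]]_p.

Section CvecHilbert.
Variables (R : realType) (p : nat).
HB.instance Definition _ := GRing.Lmodule.copy (Cvec R p) 'cV[R[i]]_p.

Definition Cvec_dot (x y : Cvec R p) : R[i] := \sum_(i < p) x i 0 * conjC (y i 0).

Let dotDl y : zmod_morphism (Cvec_dot^~ y).
Proof.
move=> x x'; rewrite /Cvec_dot -sumrB; apply: eq_bigr => i _.
by rewrite !mxE mulrBl.
Qed.

Let dotDr x : zmod_morphism (Cvec_dot x).
Proof.
move=> y y'; rewrite /Cvec_dot -sumrB; apply: eq_bigr => i _.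
by rewrite !mxE rmorphB mulrBr.
Qed.

Let dotZl y : scalable_for *%R (Cvec_dot^~ y).
Proof.
move=> a x; rewrite /Cvec_dot mulr_sumr; apply: eq_bigr => i _.
by rewrite !mxE mulrA.
Qed.

Let dotZr x : scalable_for (conjC \; *%R) (Cvec_dot x).
Proof.
move=> a y; rewrite /Cvec_dot /= mulr_sumr; apply: eq_bigr => i _.
by rewrite !mxE rmorphM mulrCA.
Qed.

HB.instance Definition _ := @isBilinear.Build _ _ _ _ _ _ Cvec_dot
  dotDl dotDr dotZl dotZr.

Let dotC x y : Cvec_dot x y = (-1) ^+ false * conjC (Cvec_dot y x).
Proof.
rewrite expr0 mul1r /Cvec_dot rmorph_sum; apply: eq_bigr => i _.
by rewrite rmorphM /= conjCK mulrC.
Qed.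

HB.instance Definition _ :=
  @isHermitianSesquilinear.Build _ _ false conjC Cvec_dot dotC.

Let dotxx x : Cvec_dot x x = (\sum_(i < p) sqmod (x i 0))%:C.
Proof.
rewrite rmorph_sum; apply: eq_bigr => i _.
by rewrite -normCK normc_sqmod.
Qed.

Let dot_gt0 x : x != 0 -> 0 < Cvec_dot x x.
Proof.
move=> x0; rewrite dotxx ltcR lt_neqAle sumr_ge0 ?andbT; last first.
  by move=> i _; exact: sqmod_ge0.
apply: contra x0; rewrite eq_sym psumr_eq0 => [|i _]; last exact: sqmod_ge0.
move=> /allP x0; apply/eqP/matrixP => i j; rewrite mxE ord1.
by apply/sqmod_eq0/eqP/x0; rewrite mem_index_enum.
Qed.

HB.instance Definition _ := @isDotProduct.Build _ _ Cvec_dot dot_gt0.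

Let d : {dot (Cvec R p) for conjC} := Cvec_dot.
HB.instance Definition _ := Lmodule_isNormed.Build R[i] (Cvec R p)
  (dot_norm_triangle d) (dot_normZ d) (@dot_norm_eq0 _ _ d).

Let normE (x : Cvec R p) : `|x| ^+ 2 = Cvec_dot x x.
Proof. exact: sqrtCK. Qed.

Let complete (F : set_system (Cvec R p)) :
  ProperFilter F -> cauchy F -> cvg F.
Proof.
move=> FF Fc.
refine (@coord_complete R (Cvec R p) 'I_p (fun i x => x i 0) _ _ uniq _ _ _ F FF Fc).
- by move=> i x y; rewrite !mxE.
- by move=> x y xy; apply/matrixP => i j; rewrite ord1.
- by [].
- move=> s x us; rewrite normE dotxx lecR [leRHS](bigID [in s]) /=.
  rewrite -(big_uniq _ us) lerDl sumr_ge0 // => i _; exact: sqmod_ge0.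
- move=> l g e e0 lg; exists (\col_i l i) => [i|]; first by rewrite mxE.
  rewrite -(@ler_pXn2r _ 2) ?nnegrE ?normr_ge0 ?lecR ?(ltW e0) // normE dotxx.
  suff : \sum_(i < p) sqmod ((\col_i l i - g) i 0) <= e ^+ 2.
    by rewrite -lecR rmorphXn.

  apply: le_trans (lg _ (index_enum_uniq _)).
  by apply: ler_sum => i _; rewrite !mxE.
Qed.

HB.instance Definition _ := Uniform_isComplete.Build (Cvec R p) complete.
HB.instance Definition _ := NormedModule_isHilbert.Build R (Cvec R p) normE.
End CvecHilbert.


Section Ell2.
Variable R : realType.
Implicit Types u v : nat -> R[i].

(* The sum of a series of complex numbers, taken on real and imaginary parts. *)
Definition csum u : R[i] :=
  limn (series (fun n => complex.Re (u n)))
  +i* limn (series (fun n => complex.Im (u n))).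

Definition csummable u := cvgn (series (fun n => complex.Re (u n))) /\
  cvgn (series (fun n => complex.Im (u n))).

Lemma csumB u v : csummable u -> csummable v ->
  csum (fun n => u n - v n) = csum u - csum v.
Proof.
move=> [uR uI] [vR vI]; rewrite /csum.
have fB (phi : R[i] -> R) : (forall z w, phi (z - w) = phi z - phi w) ->
    cvgn (series (fun n => phi (u n))) -> cvgn (series (fun n => phi (v n))) ->
    limn (series (fun n => phi (u n - v n))) =
    limn (series (fun n => phi (u n))) - limn (series (fun n => phi (v n))).
  move=> phiB cu cv; rewrite -lim_seriesN // -lim_seriesD ?is_cvg_seriesN //.
  by congr (limn (series _)); apply/funext => n; rewrite phiB.
rewrite (fB (@complex.Re R)) ?(fB (@complex.Im R)) //.
- by move=> [? ?] [? ?].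
- by move=> [? ?] [? ?].
Qed.

Lemma csumZ (a : R[i]) u : csummable u ->
  csum (fun n => a * u n) = a * csum u.
Proof.
case: a => a b [uR uI]; rewrite /csum.
set U := fun n => complex.Re (u n); set W := fun n => complex.Im (u n).
have -> : (fun n => complex.Re ((a +i* b) * u n)) = a *: U + (- b) *: W.
  by apply/funext => n; rewrite /U /W !fctE; case: (u n) => c e;
    rewrite /GRing.scale /= mulNr.
have -> : (fun n => complex.Im ((a +i* b) * u n)) = a *: W + b *: U.
  by apply/funext => n; rewrite /U /W !fctE; case: (u n) => c e.
have [aU bU] := (@is_cvg_seriesZ _ _ a uR, @is_cvg_seriesZ _ _ b uR).
have [aW bW] := (@is_cvg_seriesZ _ _ a uI, @is_cvg_seriesZ _ _ (- b) uI).
rewrite (lim_seriesD aU bW) (lim_seriesD aW bU).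
rewrite (@lim_seriesZ _ _ _ uR) (@lim_seriesZ _ _ _ uI) (@lim_seriesZ _ _ _ uI).
by rewrite (@lim_seriesZ _ _ _ uR) /GRing.scale /= mulNr.
Qed.

Lemma csumJ u : csummable u -> csum (fun n => conjC (u n)) = conjC (csum u).
Proof.
move=> [uR uI]; rewrite -[RHS]/(conjc _) /csum /= -lim_seriesN //.
congr (limn (series _) +i* limn (series _)); apply/funext => n.
  by case: (u n).
by rewrite fctE; case: (u n).
Qed.

Definition ell2_pred : {pred nat -> R[i]} :=
  fun x => `[< cvgn (series (fun n => sqmod (x n))) >].

Lemma ell2_dot_summable (x y : nat -> R[i]) : x \in ell2_pred -> y \in ell2_pred ->
  csummable (fun n => x n * conjC (y n)).
Proof.
move=> /asboolP cx /asboolP cy.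
have cxy := is_cvg_seriesD cx cy.
have bnd (u : nat -> R) : (forall n, `|u n| <= sqmod (x n) + sqmod (y n)) ->
    cvgn (series u).
  move=> uxy; apply: normed_cvg; apply: series_le_cvg cxy => n /=.
    exact: normr_ge0.
    by rewrite !fctE addr_ge0 ?sqmod_ge0.
  exact: uxy.
split; apply: bnd => n; move: (x n) (y n) => [a b] [c e].
  rewrite !sqmodE (_ : complex.Re _ = a * c + b * e); last by rewrite /= mulrN opprK.
  by rewrite ler_norml /=; apply/andP; split;
    have := sqr_ge0 (a - c); have := sqr_ge0 (a + c);
    have := sqr_ge0 (b - e); have := sqr_ge0 (b + e); nra.
rewrite !sqmodE (_ : complex.Im _ = b * c - a * e); last first.
  by rewrite /= mulrN addrC.
by rewrite ler_norml /=; apply/andP; split;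
  have := sqr_ge0 (b - c); have := sqr_ge0 (b + c);
  have := sqr_ge0 (a - e); have := sqr_ge0 (a + e); nra.
Qed.

Fact ell2_submod_closed : submod_closed ell2_pred.
Proof.
split=> [|a x y /asboolP cx /asboolP cy]; apply/asboolP.
  rewrite (_ : series _ = cst 0); first exact: is_cvg_cst.
  by apply/funext => n; rewrite /series /= big1 // => k _; exact: sqmod0.
have cxy := is_cvg_seriesD (@is_cvg_seriesZ _ _ (2 * sqmod a) cx)
  (@is_cvg_seriesZ _ _ 2 cy).
apply: series_le_cvg cxy => n; first exact: sqmod_ge0.
  rewrite !fctE /= /GRing.scale /=.
  by rewrite addr_ge0 ?mulr_ge0 ?sqmod_ge0.
rewrite !fctE (le_trans (sqmodD _ _)) // /GRing.scale /= lerD2r -mulrA.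
rewrite ler_wpM2l // -lecR rmorphM /= -!normc_sqmod -exprMn -normrM.
exact: lexx.
Qed.

HB.instance Definition _ := GRing.isSubmodClosed.Build R[i] (nat -> R[i])
  ell2_pred ell2_submod_closed.

Record ell2 := Ell2 { ell2_coord :> nat -> R[i] ; _ : ell2_coord \in ell2_pred }.
HB.instance Definition _ := [isSub for ell2_coord].
HB.instance Definition _ := [Choice of ell2 by <:].
HB.instance Definition _ := [SubChoice_isSubLmodule of ell2 by <:].

Definition ell2_dot (x y : ell2) : R[i] := csum (fun n => x n * conjC (y n)).

Let dot_summable (x y : ell2) : csummable (fun n => x n * conjC (y n)).
Proof. by apply: ell2_dot_summable; exact: valP. Qed.

Let dotDl y : zmod_morphism (ell2_dot^~ y).
Proof.
move=> x x'; rewrite /ell2_dot -csumB //; congr csum; apply/funext => n.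
by rewrite /= !fctE mulrBl.
Qed.

Let dotDr x : zmod_morphism (ell2_dot x).
Proof.
move=> y y'; rewrite /ell2_dot -csumB //; congr csum; apply/funext => n.
by rewrite /= !fctE rmorphB mulrBr.
Qed.

Let dotZl y : scalable_for *%R (ell2_dot^~ y).
Proof.
move=> a x; rewrite /ell2_dot -csumZ //; congr csum; apply/funext => n.
by rewrite /= !fctE mulrA.
Qed.

Let dotZr x : scalable_for (conjC \; *%R) (ell2_dot x).
Proof.
move=> a y; rewrite /ell2_dot /= -csumZ //; congr csum; apply/funext => n.
by rewrite /= !fctE rmorphM /= mulrCA.
Qed.

HB.instance Definition _ := @isBilinear.Build _ _ _ _ _ _ ell2_dot
  dotDl dotDr dotZl dotZr.

Let dotC x y : ell2_dot x y = (-1) ^+ false * conjC (ell2_dot y x).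
Proof.
rewrite expr0 mul1r /ell2_dot -csumJ //; congr csum; apply/funext => n.
by rewrite rmorphM /= conjCK mulrC.
Qed.

HB.instance Definition _ :=
  @isHermitianSesquilinear.Build _ _ false conjC ell2_dot dotC.

Let ell2_cvg (x : ell2) : cvgn (series (fun n => sqmod (x n))).
Proof. exact/asboolP/(valP x). Qed.

Let dotxx (x : ell2) :
  ell2_dot x x = (limn (series (fun n => sqmod (x n))))%:C.
Proof.
rewrite /ell2_dot /csum; congr (_ +i* _).
  congr (limn (series _)); apply/funext => n.
  by rewrite -normCK normc_sqmod.
rewrite (_ : series _ = cst 0) ?lim_cst //; apply/funext => n.
by rewrite /series /= big1 // => k _; rewrite -normCK normc_sqmod.
Qed.

Let le_dot s (x : ell2) : (exists N, s = index_iota 0 N) \/ (exists i, s = [:: i]) ->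
  \sum_(i <- s) sqmod (x i) <= limn (series (fun n => sqmod (x n))).
Proof.
have leN N : \sum_(0 <= i < N) sqmod (x i) <= limn (series (fun n => sqmod (x n))).
  have h := @nondecreasing_series _ (fun n => sqmod (x n)) xpredT 0
    (fun n _ _ => sqmod_ge0 (x n)).
  exact: (nondecreasing_cvgn_le h (@ell2_cvg x) N).
case=> [[N ->]|[n ->]] //.
apply: le_trans (leN n.+1); rewrite big_seq1 big_nat_recr //= lerDr.
by rewrite sumr_ge0 // => i _; exact: sqmod_ge0.
Qed.

Let dot_gt0 (x : ell2) : x != 0 -> 0 < ell2_dot x x.
Proof.
move=> x0; rewrite dotxx ltcR lt_neqAle.
have le0 : 0 <= limn (series (fun n => sqmod (x n))).
  by have := @le_dot [::] x; rewrite big_nil; apply; left; exists 0%N.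
rewrite le0 andbT; apply: contra x0 => /eqP x0.
apply/eqP/val_inj/funext => n /=; apply/sqmod_eq0/eqP.
rewrite eq_le sqmod_ge0 andbT x0.
by have := @le_dot [:: n] x; rewrite big_seq1; apply; right; exists n.
Qed.

HB.instance Definition _ := @isDotProduct.Build _ _ ell2_dot dot_gt0.

Let d : {dot ell2 for conjC} := ell2_dot.
HB.instance Definition _ := Lmodule_isNormed.Build R[i] ell2
  (dot_norm_triangle d) (dot_normZ d) (@dot_norm_eq0 _ _ d).

Let normE (x : ell2) : `|x| ^+ 2 = ell2_dot x x.
Proof. exact: sqrtCK. Qed.

Let complete (F : set_system ell2) : ProperFilter F -> cauchy F -> cvg F.
Proof.
move=> FF Fc.
refine (@coord_complete R ell2 nat (fun i x => x i) _ _
  (fun s => (exists N, s = index_iota 0 N) \/ (exists i, s = [:: i]))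
  _ _ _ F FF Fc).
- by [].
- by move=> x y xy; apply/val_inj/funext.
- by move=> i; right; exists i.
- by move=> s x fs; rewrite normE dotxx lecR le_dot.
- move=> l g e e0 lg.
  have dcvg : cvgn (series (fun n => sqmod (l n - g n))).
    apply: nondecreasing_is_cvgn.
      by apply: nondecreasing_series => n _ _; exact: sqmod_ge0.
    by exists (e ^+ 2) => _ [N _ <-]; apply: lg; left; exists N.
  have dP : (fun n => l n - g n) \in ell2_pred by apply/asboolP.
  exists (g + Ell2 dP) => [i|]; first by rewrite /= !fctE addrC subrK.
  rewrite addrC addKr.
  rewrite -(@ler_pXn2r _ 2) ?nnegrE ?normr_ge0 ?lecR ?(ltW e0) // normE dotxx.
  suff : limn (series (fun n => sqmod (l n - g n))) <= e ^+ 2.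
    by rewrite -lecR rmorphXn.
  by apply: limr_le => //; near=> N; apply: lg; left; exists N.
Unshelve. all: by end_near. Qed.

HB.instance Definition _ := Uniform_isComplete.Build ell2 complete.
HB.instance Definition _ := NormedModule_isHilbert.Build R ell2 normE.
End Ell2.


Fact ell2_shift_subproof (R : realType) (x : ell2 R) :
  (fun n => if n is k.+1 then x k else 0) \in @ell2_pred R.
Proof.
apply/asboolP.
have /asboolP cx := valP x.
have h := @nondecreasing_series _ (fun n => sqmod (x n)) xpredT 0
  (fun n _ _ => sqmod_ge0 (x n)).
apply: nondecreasing_is_cvgn.
  by apply: nondecreasing_series => n _ _; exact: sqmod_ge0.
exists (limn (series (fun n => sqmod (x n)))) => _ [[|N] _ <-].
  apply: le_trans (nondecreasing_cvgn_le h cx 0%N).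
  by rewrite /series /= !big_geq.
apply: le_trans (nondecreasing_cvgn_le h cx N).
by rewrite /series /= big_nat_recl //= sqmod0 add0r.
Qed.

(* S e_n = e_{n+1}. *)
Definition ell2_shift (R : realType) (x : ell2 R) : ell2 R :=
  Ell2 (ell2_shift_subproof x).

(* J_p e_n = e_{n+1} for n < p, and J_p e_p = 0: the column of index j of the
   matrix is the basis vector of index j + 1, if there is one. *)
Definition truncated_shift (R : realType) (p : nat) (x : Cvec R p) : Cvec R p :=
  (\matrix_(i < p, j < p) (i == j.+1 :> nat)%:R) *m x.

Section Subspaces.
Variables (R : realType) (H : hilbertType R).
Implicit Types K A : set H.

Definition is_subspace K :=
  K 0 /\ forall (a : R[i]) (x y : H), K x -> K y -> K (a *: x + y).

Definition closed_subspace K := is_subspace K /\ closed K.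

Definition closed_span A : set H := smallest closed_subspace A.

Definition orthogonal_sets A B := forall x y : H, A x -> B y -> hdot x y = 0.

(* The value is the nearest point of K, which exists as soon as K is a closed
   subspace; otherwise it defaults to 0. *)
Definition orthproj K (x : H) : H :=
  xget 0 [set y | K y /\ forall z, K z -> hdot (x - y) z = 0].

(* H is the internal Hilbert space direct sum of the K i. *)
Definition orth_direct_sum (I : Type) (K : I -> set H) :=
  [/\ forall i, closed_subspace (K i),
      forall i j, i <> j -> orthogonal_sets (K i) (K j) &
      closed_span (\bigcup_i K i) = setT].

End Subspaces.

Section Operators.
Variables (R : realType) (H L : hilbertType R).

Definition bounded_op (T : H -> L) :=
  exists M : R, forall x, `|T x| <= M%:C * `|x|.

(* For bounded linear T, the set is a singleton by the Riesz theorem. *)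
Definition adjoint (T : H -> L) (y : L) : H :=
  xget 0 [set z | forall x, hdot (T x) y = hdot x z].

Definition partial_isometry (T : H -> L) :=
  forall x, (forall y, T y = 0 -> hdot x y = 0) -> `|T x| = `|x|.

Definition unitary_between (W : H -> L) (A : set H) (B : set L) :=
  (forall x y, A x -> A y -> hdot (W x) (W y) = hdot x y) /\ W @` A = B.

End Operators.

Section PowerPartialIsometries.
Variables (R : realType) (H : hilbertType R).
Implicit Types (T : H -> H) (K : set H).

Definition power_partial_isometry T := forall n, partial_isometry (iter n T).

Definition reducing T K :=
  [/\ closed_subspace K, T @` K `<=` K & adjoint T @` K `<=` K].

Definition unitarily_equivalent_on T K (L : hilbertType R) (X : L -> L) :=
  exists W : {linear L -> H},
    unitary_between W setT K /\ forall x, T (W x) = W (X x).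

Definition proj_ranges T : H -> H :=
  orthproj (\bigcap_(n in [set n | (1 <= n)%N]) range (iter n T)).

Definition proj_adjoint_ranges T : H -> H :=
  orthproj (\bigcap_(n in [set n | (1 <= n)%N]) range (iter n (adjoint T))).

Definition H_u T : set H := range (proj_ranges T \o proj_adjoint_ranges T).

Definition H_s T : set H :=
  range ((idfun \- proj_ranges T) \o proj_adjoint_ranges T).

Definition H_b T : set H :=
  range ((idfun \- proj_adjoint_ranges T) \o proj_ranges T).

Definition final_proj T n (x : H) : H := iter n T (iter n (adjoint T) x).

Definition initial_proj T n (x : H) : H := iter n (adjoint T) (iter n T x).

(* A sum of p subspaces, each the range of a product of two operators. *)
Definition H_p T p : set H :=
  [set v | exists h : nat -> H, v = \sum_(1 <= n < p.+1)
     (final_proj T (n - 1) \- final_proj T n)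
       ((initial_proj T (p - n) \- initial_proj T (p - n + 1)) (h n))].

Inductive summand := Unitary | Forward | Backward | Truncated of nat.

(* Truncated k stands for the summand of index p = k + 1. *)
Definition summand_space T (i : summand) : set H :=
  match i with
  | Unitary => H_u T
  | Forward => H_s T
  | Backward => H_b T
  | Truncated k => H_p T k.+1
  end.

End PowerPartialIsometries.

(* A Hilbert space tensor product of L and M, which is determined up to a
   unique unitary compatible with the elementary tensors. *)
Record hilbert_tensor (R : realType) (L M : hilbertType R) := HilbertTensor {
  tensor_space :> hilbertType R ;
  tensor : {bilinear L -> M -> tensor_space} ;
  hdot_tensor : forall x x' y y',
    hdot (tensor x y) (tensor x' y') = hdot x x' * hdot y y' ;
  tensor_total : closed_span [set tensor x y | x in setT & y in setT] = setT
}.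

Section TensorOperators.
Variables (R : realType) (L M : hilbertType R).

(* X = A (x) B; elementary tensors are total, so A and B determine X. *)
Definition is_tensor_op (E : hilbert_tensor L M) (A : L -> L) (B : M -> M)
    (X : {linear E -> E}) :=
  bounded_op X /\ forall x y, X (tensor E x y) = tensor E (A x) (B y).

(* The restriction of T to K is unitarily equivalent to A (x) 1 on L (x) M. *)
Definition unitarily_equivalent_to_tensor (H : hilbertType R) (T : H -> H)
    (K : set H) (A : L -> L) :=
  exists (E : hilbert_tensor L M) (X : {linear E -> E}),
    is_tensor_op A idfun X /\ unitarily_equivalent_on T K X.

End TensorOperators.

(* Main.v *)
Require Import Defs.
From HB Require Import structures.
From mathcomp Require Import all_boot all_order all_algebra complex.
From mathcomp Require Import boolp classical_sets functions reals.
From mathcomp Require Import topology normedtype sequences.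
From mathcomp Require Import ring lra.
Set Implicit Arguments.
Unset Strict Implicit.
Unset Printing Implicit Defensive.
Import Order.TTheory GRing.Theory Num.Theory.
Import numFieldNormedType.Exports.
Local Open Scope classical_set_scope.
Local Open Scope ring_scope.

(** Write S for the adjoint of T, E_n for T^n S^n and F_n for S^n T^n. As T^n is
    a partial isometry, E_n and F_n are projections, decreasing in n. The key
    fact, due to Halmos and Wallen, is that every E_m commutes with every F_n:
    T^(n+m) is a partial isometry as well, which makes F_n E_m idempotent
    ([range_proj_comm]), and two projections with an idempotent product commute
    ([projectors_commute]). Together with the intertwining relations
    T E_n = E_(n+1) T and T F_(n+1) = F_n T, this reduces the decomposition to
    algebra in a commuting family of projections.

    P is the projection onto the common fixed space of the E_n. It commutes with
    every operator which, together with its adjoint, preserves that space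
    ([proj_ranges_comm]); this gives its commutation with T, S, each F_n and
    then Q, without writing P as a strong limit.

    The corners R_(a,b) = (E_a - E_(a+1)) (F_b - F_(b+1)) are mutually
    orthogonal projections. T carries R_(a,b+1) to R_(a+1,b) and kills R_(a,0),
    so the sum of the R_(a,b) over a + b = p - 1 commutes with T and with S, and
    its range is H_p. The summands exhaust H ([decomposition_total]): if
    P x = Q x = 0 and all corners kill x, then y = (E_a - E_(a+1)) x is fixed by
    all F_b, so y = Q y = (E_a - E_(a+1)) Q x = 0; hence all E_n fix x, and
    x = P x = 0.

    For the models, M_s is the intersection of ker S with QH, M_b that of ker T
    with PH, and M_p is the range of R_(0,p-1). On H_s and H_p the vectors T^n m
    with m in the multiplicity space (and n < p in the case of H_p) satisfy
    <T^n m, T^k m'> = delta <m, m'>, where delta is 1 if n = k and 0 otherwise,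
    and are total; on H_b the same holds for S^n m. The tensor product is therefore
    realised on the summand itself, with x tensor m the sum of the x_n T^n m,
    and the unitary equivalence is the inclusion ([restricted_tensor_model]).
    The sum needs no convergence argument: x tensor m is the image of x under
    the adjoint of the coefficient map sending w to the family of the
    <w, T^n m>, which is bounded by the Bessel inequality ([tensor_model]).

    What this requires from Hilbert space theory is the projection theorem
    ([exists_projection]) and the Riesz representation theorem ([riesz]). *)

(** * Inner products, projections and the Riesz theorem *)

Section InnerProduct.
Variables (R : realType) (H : hilbertType R).
Implicit Types (x y z : H) (a : R[i]).

Lemma hdotDl x y z : hdot (x + y) z = hdot x z + hdot y z.
Proof. exact: linearDl. Qed.
Lemma hdotDr x y z : hdot x (y + z) = hdot x y + hdot x z.
Proof. exact: linearDr. Qed.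
Lemma hdotBl x y z : hdot (x - y) z = hdot x z - hdot y z.
Proof. exact: linearBl. Qed.
Lemma hdotBr x y z : hdot x (y - z) = hdot x y - hdot x z.
Proof. exact: linearBr. Qed.
Lemma hdotZl a x y : hdot (a *: x) y = a * hdot x y.
Proof. exact: linearZl_LR. Qed.
Lemma hdotZr a x y : hdot x (a *: y) = a^* * hdot x y.
Proof. exact: linearZr_LR. Qed.
Lemma hdot0l x : hdot 0 x = 0.
Proof. exact: linear0l. Qed.
Lemma hdot0r x : hdot x 0 = 0.
Proof. exact: linear0r. Qed.
Lemma hdotC x y : hdot x y = (hdot y x)^*.
Proof. by rewrite (hermC hdot) expr0 mul1r. Qed.
Lemma hdot_suml (I : Type) (r : seq I) (P : pred I) (F : I -> H) y :
  hdot (\sum_(i <- r | P i) F i) y = \sum_(i <- r | P i) hdot (F i) y.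
Proof. exact: linear_sumlz. Qed.
Lemma hdot_sumr (I : Type) (r : seq I) (P : pred I) (F : I -> H) x :
  hdot x (\sum_(i <- r | P i) F i) = \sum_(i <- r | P i) hdot x (F i).
Proof. exact: linear_sumr. Qed.

Lemma hdot_sym0 x y : hdot x y = 0 -> hdot y x = 0.
Proof. by rewrite (hdotC y) => ->; rewrite conjC0. Qed.

Lemma hdot_eq0 x : hdot x x = 0 -> x = 0.
Proof. by move/eqP; rewrite dnorm_eq0 => /eqP. Qed.

Lemma hdot_inj x y : (forall z, hdot x z = hdot y z) -> x = y.
Proof.
move=> xy; apply/subr0_eq/hdot_eq0.
by rewrite hdotBl xy subrr.
Qed.

Lemma hdot_injr x y : (forall z, hdot z x = hdot z y) -> x = y.
Proof. by move=> xy; apply: hdot_inj => z; rewrite hdotC xy -hdotC. Qed.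

Lemma hdot_le x y : `|hdot x y| <= `|x| * `|y|.
Proof.
rewrite -(@ler_pXn2r _ 2) ?nnegrE ?mulr_ge0 ?normr_ge0 //.
by rewrite exprMn !hdot_norm dot_CauchySchwarz.
Qed.

Lemma norm_le x y : hdot x x <= hdot y y -> `|x| <= `|y|.
Proof. by rewrite -!hdot_norm ler_pXn2r ?nnegrE ?normr_ge0. Qed.

Definition orth (A : set H) : set H := [set x | forall y, A y -> hdot x y = 0].

Lemma orth_subspace A : is_subspace (orth A).
Proof.
split=> [y _|a x y ax ay z Az]; first exact: hdot0l.
by rewrite hdotDl hdotZl ax // ay // mulr0 add0r.
Qed.

(** Stated for bare additive functionals so as to serve orthogonal complements
    as well as the functionals to which the Riesz theorem is applied in
    [adjoint_pairP]. *)
Lemma closed_kernel (f : H -> R[i]) (M : R[i]) :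
  {morph f : x y / x - y} -> (forall x, `|f x| <= M * `|x|) ->
  M \is Num.real -> closed [set x | f x = 0].
Proof.
move=> fB fM /real_ler_norm Mle x clx /=; apply/eqP/negPn/negP => fx0.
have N0 : 0 < `|M| + 1 by rewrite ltr_wpDl.
(* The radius makes |f (x - z)| < |f x| for z in the ball, which is absurd if
   f z = 0. *)
have e0 : 0 < `|f x| / (`|M| + 1) by rewrite divr_gt0 // normr_gt0.
have [z [/= fz]] := clx _ (nbhsx_ballx x _ e0).
rewrite -ball_normE /= ltr_pdivlMr // => xz.
suff : `|f (x - z)| < `|f x| by rewrite fB fz subr0 ltxx.
apply: le_lt_trans xz; apply: (le_trans (fM _)); rewrite mulrC.
by rewrite ler_wpM2l // (le_trans Mle) // lerDl.
Qed.

Lemma orth_closed A : closed (orth A).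
Proof.
rewrite (_ : orth A = \bigcap_(y in A) [set x | hdot x y = 0]) //.
apply: closed_bigI => y _; apply: (@closed_kernel _ `|y|).
  by move=> x z; exact: hdotBl.
  by move=> x; rewrite mulrC hdot_le.
exact: normr_real.
Qed.

Lemma orth_closed_subspace A : closed_subspace (orth A).
Proof. by split; [exact: orth_subspace | exact: orth_closed]. Qed.

(** Norms and inner products take values in R[i]; the squared norm is needed in
    R itself for infima and for real arithmetic. *)
Definition sqnorm x : R := complex.Re (hdot x x).

Lemma sqnormE x : (sqnorm x)%:C%C = hdot x x.
Proof. by rewrite /sqnorm RRe_real // realE dnorm_ge0. Qed.

Lemma sqnorm_ge0 x : 0 <= sqnorm x.
Proof. by rewrite -lecR sqnormE dnorm_ge0. Qed.

Lemma parallelogram x y :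
  sqnorm (x + y) + sqnorm (x - y) = sqnorm x *+ 2 + sqnorm y *+ 2.
Proof.
rewrite !mulr2n; apply: (@complexI R); rewrite !rmorphD /= !sqnormE.
rewrite !hdotBl !hdotBr !hdotDl !hdotDr.
set a := hdot x x; set b := hdot x y; set c := hdot y x; set d := hdot y y.
by ring.
Qed.

End InnerProduct.

Section Projection.
Variables (R : realType) (H : hilbertType R).
Implicit Types (x y z : H) (K A : set H).

Lemma sqnormZ (t : R) x : sqnorm (t%:C%C *: x) = t ^+ 2 * sqnorm x.
Proof.
apply: (@complexI R); rewrite rmorphM rmorphXn /= !sqnormE hdotZl hdotZr.
by rewrite (_ : (t%:C%C)^* = t%:C%C) ?mulrA ?expr2 //; exact: conjc_real.
Qed.

Lemma norm_lt x (e : R) : 0 < e -> sqnorm x < e ^+ 2 -> `|x| < e%:C%C.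
Proof.
move=> e0 xe; rewrite -(@ltr_pXn2r _ 2) ?nnegrE ?normr_ge0 ?lecR ?(ltW e0) //.
by rewrite hdot_norm -sqnormE -rmorphXn ltcR.
Qed.

Lemma norm_sqnorm x (e : R) : 0 <= e -> `|x| <= e%:C%C -> sqnorm x <= e ^+ 2.
Proof.
move=> e0 xe; rewrite -lecR sqnormE -hdot_norm rmorphXn /=.
by rewrite ler_pXn2r ?nnegrE ?normr_ge0 ?lecR.
Qed.

(** Parallelogram law for x - y and x - z: the midpoint of y and z lies in K,
    hence at squared distance at least d from x. *)
Lemma midpoint_le K x (d e : R) : is_subspace K ->
  (forall y, K y -> d <= sqnorm (x - y)) ->
  forall y z, K y -> K z -> sqnorm (x - y) < d + e -> sqnorm (x - z) < d + e ->
  sqnorm (y - z) < e *+ 4.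
Proof.
move=> [K0 Kl] dK y z Ky Kz xy xz.
have := parallelogram (x - z) (x - y).
have -> : x - z - (x - y) = y - z by rewrite opprB addrCA addrAC subrr add0r.
pose m := (2^-1 : R)%:C%C *: (y + z).
have Km : K m.
  have := Kl 1 _ _ Ky Kz; rewrite scale1r => Kyz.
  by have := Kl (2^-1 : R)%:C%C _ _ Kyz K0; rewrite addr0.
have -> : x - z + (x - y) = (2 : R)%:C%C *: (x - m).
  rewrite scalerBr scalerA -rmorphM /= divff ?pnatr_eq0 // rmorph1 scale1r.
  by rewrite rmorph_nat scaler_nat mulr2n opprD addrACA [- z + _]addrC.
rewrite sqnormZ; have := dK _ Km; nra.
Qed.

Lemma closed_norm_le x (r : R[i]) : r \is Num.real ->
  closed [set y | `|x - y| <= r].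
Proof.
move=> rR y cly /=; rewrite real_leNgt // ?normr_real //; apply/negP => ry.
have e0 : 0 < `|x - y| - r by rewrite subr_gt0.
have [z [/= xz]] := cly _ (nbhsx_ballx y _ e0).
rewrite -ball_normE /= distrC ltrBrDl => yz.
have := le_lt_trans (le_trans (ler_distD z x y) (lerD xz (lexx _))) yz.
by rewrite ltxx.
Qed.

(** The points of K whose squared distance to x is less than the infimum plus e
    form, as e varies, a filter base, which is Cauchy by [midpoint_le]. *)
Lemma exists_nearest K x : closed_subspace K ->
  exists2 y, K y & forall z, K z -> sqnorm (x - y) <= sqnorm (x - z).
Proof.
move=> [Ks Kc]; have [K0 Kl] := Ks.
pose D := [set sqnorm (x - y) | y in K].
have Dinf : has_inf D.
  split; first by exists (sqnorm (x - 0)), 0.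
  by exists 0 => _ [y _ <-]; exact: sqnorm_ge0.
pose d := inf D.
have dK y : K y -> d <= sqnorm (x - y).
  by move=> Ky; apply: ge_inf; [case: Dinf | exists y].
pose B (e : R) := [set y | K y /\ sqnorm (x - y) < d + e].
pose F := filter_from [set e : R | 0 < e] B.
have FF : ProperFilter F.
  apply: filter_from_proper; last first.
    move=> e /= e0; have [_ [y Ky <-] xy] := inf_adherent e0 Dinf.
    by exists y.
  apply: filter_from_filter; first by exists 1 => /=.
  move=> e f /= e0 f0; exists (Num.min e f); first by rewrite /= lt_min e0.
  by move=> y [Ky xy]; split; split => //; apply: (lt_le_trans xy);
    rewrite lerD2l ge_min lexx ?orbT.
have FB e : 0 < e -> F (B e) by move=> e0; exists e.
have Fc : cauchy F.
  apply/cauchyP => e e0.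
  have eR : e = (complex.Re e)%:C%C by rewrite RRe_real // gtr0_real.
  have e0' : 0 < complex.Re e by rewrite -ltcR -eR.
  (* With slack f the midpoint estimate gives squared distance at most
     4 f = r^2. *)
  set r := complex.Re e in eR e0'; pose f := r ^+ 2 / 4.
  have f0 : 0 < f by rewrite divr_gt0 ?exprn_gt0.
  have [y [Ky xy]] := filter_ex (FB _ f0).
  exists y; apply: filterS (FB _ f0) => z [Kz xz].
  rewrite -ball_normE /= eR norm_lt //.
  have := midpoint_le Ks dK Ky Kz xy xz.
  by rewrite -mulr_natr /f divfK ?pnatr_eq0.
have /cvg_ex [l Fl] : cvg F by apply: cauchy_cvg.
have Kl' : K l.
  apply: (@closed_cvg _ _ F _ id K Kc _ l) => //.
  by apply: filterS (FB _ ltr01) => y [].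
exists l => // z Kz; apply: le_trans (dK _ Kz).
have dd e : 0 < e -> sqnorm (x - l) <= d + e.
  move=> e0.
  have clo : closed [set y : H | `|x - y| <= (Num.sqrt (d + e))%:C%C].
    exact/closed_norm_le/complex_realP/ex_intro.
  have d0 : 0 <= d + e.
    rewrite addr_ge0 ?(ltW e0) //; apply: lb_le_inf; first by case: Dinf.
    by move=> _ [y _ <-]; exact: sqnorm_ge0.
  have := @closed_cvg _ _ F _ id _ clo _ l Fl.
  rewrite /mkset => /(_ _) h; rewrite -(sqr_sqrtr d0).
  apply: norm_sqnorm; first exact: sqrtr_ge0.
  apply: h; apply: filterS (FB _ e0) => y [Ky xy] /=.
  rewrite -(@ler_pXn2r _ 2) ?nnegrE ?normr_ge0 ?lecR ?sqrtr_ge0 //.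
  by rewrite hdot_norm -sqnormE -rmorphXn lecR sqr_sqrtr // ltW.
by apply/ler_addgt0Pr => e /dd.
Qed.

(** The nearest point y is the projection: with u = x - y and z in K, moving from
    y by a = <u, z> / <z, z> times z would bring x strictly closer unless
    a = 0. *)
Lemma exists_projection K x : closed_subspace K ->
  exists2 y, K y & orth K (x - y).
Proof.
move=> Kc; have [[K0 Kl] _] := Kc.
have [y Ky ymin] := exists_nearest x Kc.
exists y => // z Kz; set u := x - y.
have [->|z0] := eqVneq z 0; first exact: hdot0r.
have zz : hdot z z != 0 by rewrite dnorm_eq0.
pose a := hdot u z / hdot z z.
have uz : hdot (u - a *: z) z = 0 by rewrite hdotBl hdotZl divfK // subrr.
have : hdot u u <= hdot (u - a *: z) (u - a *: z).
  rewrite -!sqnormE lecR; have -> : u - a *: z = x - (a *: z + y).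
    by rewrite /u opprD addrA addrAC.
  exact: ymin (Kl _ _ _ Kz Ky).
have -> : hdot u u = hdot (u - a *: z) (u - a *: z) + hdot (a *: z) (a *: z).
  have := hnormDd (form := hdot) (u := u - a *: z) (v := a *: z).
  by rewrite subrK [X in X = 0]hdotZr uz mulr0 => ->.
rewrite gerDl hdotZl hdotZr mulrA => h.
have : hdot (a *: z) (a *: z) = 0.
  by apply/eqP; rewrite eq_le dnorm_ge0 hdotZl hdotZr mulrA h.
move/hdot_eq0/eqP; rewrite scaler_eq0 (negPf z0) orbF mulf_eq0 invr_eq0.
by rewrite (negPf zz) orbF => /eqP.
Qed.

Lemma orthprojP K x : closed_subspace K ->
  K (orthproj K x) /\ orth K (x - orthproj K x).
Proof.
move=> Kc; rewrite /orthproj; case: xgetP => [y _ [//]|] no.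
by have [y Ky yo] := exists_projection x Kc; case: (no y).
Qed.

Lemma orthproj_uniq K x y : closed_subspace K -> K y -> orth K (x - y) ->
  orthproj K x = y.
Proof.
move=> Kc Ky xy; have [Kp xp] := orthprojP x Kc.
apply/subr0_eq/hdot_eq0; set p := orthproj K x in Kp xp *.
have Kpy : K (p - y).
  by have [[_ Kl] _] := Kc; rewrite addrC -scaleN1r; exact: Kl.
have {1}-> : p - y = (x - y) - (x - p).
  by rewrite opprB [RHS]addrC addrA addrNK.
by rewrite hdotBl xy // xp // subrr.
Qed.

(** Both totality conditions of the theorem, for the direct sum and for the
    tensor products, are checked through this criterion. *)
Lemma closed_span_eqT A : (forall x, orth A x -> x = 0) ->
  closed_span A = setT.
Proof.
move=> A0; apply/seteqP; split=> // x _ K [Kc AK].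
have [Kp xp] := orthprojP x Kc.
suff /subr0_eq -> : x - orthproj K x = 0 by [].
by apply: A0 => y /AK; exact: xp.
Qed.

(** If f v <> 0 with v orthogonal to ker f, then x - (f x / f v) v lies in ker f
    and pairing it with v expresses f x as an inner product. *)
Lemma riesz (f : H -> R[i]) :
  (forall a x y, f (a *: x + y) = a * f x + f y) ->
  closed [set x | f x = 0] -> exists z, forall x, f x = hdot x z.
Proof.
move=> fl fc; pose K := [set x | f x = 0].
have f0 : f 0 = 0.
  have := fl 1 0 0; rewrite scale1r addr0 mul1r => /eqP.
  by rewrite addrC -subr_eq subrr => /eqP <-.
have Kc : closed_subspace K.
  split=> //; split=> // a x y Kx Ky; rewrite /K /= fl Kx Ky mulr0 addr0 //.
have [Kall|] := pselect (forall x, f x = 0).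
  by exists 0 => x; rewrite hdot0r Kall.
move/existsNP => [u fu]; have [Kp up] := orthprojP u Kc.
set v := u - orthproj K u in up.
have fv : f v = f u.
  by rewrite /v addrC -scaleN1r fl Kp mulr0 add0r.
have fv0 : f v != 0 by rewrite fv; apply/eqP.
have vv : hdot v v != 0.
  by rewrite dnorm_eq0; apply: contra_neq fv0 => ->.
exists ((f v / hdot v v)^* *: v) => x.
have : K (x - (f x / f v) *: v).
  by rewrite /K /= addrC -scaleNr fl mulNr divfK // addNr.
move/up/hdot_sym0; rewrite hdotBl hdotZl => /subr0_eq xv.
by rewrite hdotZr conjCK xv; field; rewrite fv0.
Qed.

End Projection.

(** * Adjoint pairs and projectors *)

Section AdjointPairs.
Variables (R : realType).

(** The relation between an operator and its adjoint, for bare functions: it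
    makes both of them linear, so that no linear or bounded structure has to be
    carried through iterates, products and differences. *)
Definition adjoint_pair (H L : hilbertType R) (A : H -> L) (B : L -> H) :=
  forall x y, hdot (A x) y = hdot x (B y).

Lemma adjoint_pair_sym (H L : hilbertType R) (A : H -> L) (B : L -> H) :
  adjoint_pair A B -> adjoint_pair B A.
Proof. by move=> AB x y; rewrite hdotC -AB -hdotC. Qed.

Lemma adjoint_pairP (H L : hilbertType R) (A : H -> L) (M : R) :
  linear A -> (forall x, `|A x| <= M%:C%C * `|x|) ->
  adjoint_pair A (adjoint A).
Proof.
move=> Al AM x y; rewrite /adjoint; case: xgetP => [z _ -> //|no].
have [||z Az] := @riesz R H (fun x => hdot (A x) y).
- by move=> a u v; rewrite Al hdotDl hdotZl.
- apply: (@closed_kernel _ _ _ (M%:C%C * `|y|)).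
  + by move=> u v; rewrite addrC -scaleN1r Al scaleN1r addrC hdotBl.
  + move=> u; apply: (le_trans (hdot_le _ _)).
    by rewrite mulrAC ler_wpM2r.
  + by rewrite realM ?normr_real //; apply/complex_realP; exists M.
by case: (no z).
Qed.

Section Linearity.
Variables (H L : hilbertType R) (A : H -> L) (B : L -> H).
Hypothesis AB : adjoint_pair A B.

Lemma adjoint_pair_linear : linear A.
Proof.
by move=> a x y; apply: hdot_inj => z; rewrite AB !hdotDl !hdotZl !AB.
Qed.
Lemma adjoint_pair0 : A 0 = 0.
Proof. by apply: hdot_inj => z; rewrite AB !hdot0l. Qed.
Lemma adjoint_pairD x y : A (x + y) = A x + A y.
Proof. by apply: hdot_inj => z; rewrite AB !hdotDl !AB. Qed.
Lemma adjoint_pairB x y : A (x - y) = A x - A y.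
Proof. by apply: hdot_inj => z; rewrite AB !hdotBl !AB. Qed.
Lemma adjoint_pairZ a x : A (a *: x) = a *: A x.
Proof. by apply: hdot_inj => z; rewrite AB !hdotZl !AB. Qed.
Lemma adjoint_pair_sum (I : Type) (r : seq I) (P : pred I) (F : I -> H) :
  A (\sum_(i <- r | P i) F i) = \sum_(i <- r | P i) A (F i).
Proof. exact: (big_morph _ adjoint_pairD adjoint_pair0). Qed.

Lemma adjointE : adjoint A = B.
Proof.
apply/funext => y; rewrite /adjoint; case: xgetP => [z _ zP|no].
  by apply: hdot_injr => x; rewrite -zP AB.
by case: (no (B y)) => x; rewrite AB.
Qed.
End Linearity.

Lemma adjoint_pair_iter (H : hilbertType R) (A B : H -> H) n :
  adjoint_pair A B -> adjoint_pair (iter n A) (iter n B).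
Proof.
move=> AB; elim: n => [//|n IH] x y.
by rewrite iterS iterSr AB IH.
Qed.

Lemma adjoint_pair_sub (H L : hilbertType R) (A A' : H -> L) (B B' : L -> H) :
  adjoint_pair A B -> adjoint_pair A' B' -> adjoint_pair (A \- A') (B \- B').
Proof. by move=> AB AB' x y; rewrite /= hdotBl hdotBr AB AB'. Qed.

Variable H : hilbertType R.
Implicit Types (A B E F : H -> H) (K : set H).

Definition projector E := adjoint_pair E E /\ forall x, E (E x) = E x.

Lemma projector_comp E F : projector E -> projector F ->
  (forall x, E (F x) = F (E x)) -> projector (E \o F).
Proof.
move=> [EE E2] [FF F2] EF; split=> [x y|x] /=; first by rewrite EE FF EF.
by rewrite -(EF (F x)) F2 E2.
Qed.

Lemma projector_sub E F : projector E -> projector F ->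
  (forall x, E (F x) = F x) -> projector (E \- F).
Proof.
move=> [EE E2] [FF F2] EF.
have FE x : F (E x) = F x.
  by apply: hdot_inj => z; rewrite FF EE EF FF.
split=> [|x]; first exact: adjoint_pair_sub.
by rewrite /= (adjoint_pairB EE) (adjoint_pairB FF) E2 EF FE F2 subrr subr0.
Qed.

Lemma projector_compl E : projector E -> projector (idfun \- E).
Proof. by move=> pE; apply: projector_sub. Qed.

(** An idempotent product F E of projections gives |F E x|^2 = <E F E x, F E x>,
    which means that E fixes F E x. So F E = E F E, which is self-adjoint, and
    therefore equals E F. *)
Lemma projectors_commute (E F : H -> H) : projector E -> projector F ->
  (forall x, F (E (F (E x))) = F (E x)) -> forall x, E (F x) = F (E x).
Proof.
move=> [EE E2] [FF F2] FE2.
have normE u : hdot (u - E u) (u - E u) = hdot u u - hdot (E u) u.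
  rewrite hdotBr -(EE (u - E u) u) (adjoint_pairB EE) E2 subrr hdot0l.
  by rewrite subr0 hdotBl.
have EFE x : E (F (E x)) = F (E x).
  apply/esym/subr0_eq/hdot_eq0; rewrite normE.
  by rewrite (FF (E x) (F (E x))) F2 -(FF (E (F (E x))) (E x)) FE2 FF subrr.
move=> x; apply: hdot_inj => z.
by rewrite EE FF -(EFE z) -EE -FF -EE EFE.
Qed.

Lemma projector_sum n (E : 'I_n -> H -> H) :
  (forall i, projector (E i)) ->
  (forall i j x, i != j -> E i (E j x) = 0) ->
  projector (fun x => \sum_i E i x).
Proof.
move=> pE oE; split=> [x y|x].
  rewrite hdot_suml hdot_sumr; apply: eq_bigr => i _.
  by have [-> //] := pE i.
apply: eq_bigr => i _; have [EE E2] := pE i.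
rewrite (adjoint_pair_sum EE) (bigD1 i) //= big1 ?addr0 ?E2 // => j ji.
by rewrite oE // eq_sym.
Qed.

Lemma projector_range E : projector E -> range E = [set x | E x = x].
Proof.
move=> [_ E2]; apply/seteqP; split=> [_ [x _ <-] //=|x /= Ex].
by exists x.
Qed.

Lemma projector_range_closed E : projector E -> closed_subspace (range E).
Proof.
move=> pE; have [EE E2] := pE; rewrite projector_range //.
rewrite (_ : mkset _ = orth (range (idfun \- E))).
  exact: orth_closed_subspace.
apply/seteqP; split=> [x /= Ex _ [y _ <-]|x /= xo].
  by rewrite hdotBr -EE Ex subrr.
apply: hdot_inj => z; apply/esym/subr0_eq.
by rewrite EE -hdotBr; apply: xo; exists z.
Qed.

Lemma orthproj_id K x : closed_subspace K -> K x -> orthproj K x = x.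
Proof.
by move=> Kc Kx; apply: orthproj_uniq => // y _; rewrite subrr hdot0l.
Qed.

(** The hypotheses say that A preserves both K and its orthogonal complement, so
    it respects the decomposition of x along them. *)
Lemma orthproj_comm K A B : closed_subspace K -> adjoint_pair A B ->
  (forall x, K x -> K (A x)) -> (forall x, K x -> K (B x)) ->
  forall x, orthproj K (A x) = A (orthproj K x).
Proof.
move=> Kc AB KA KB x; have [Kp xp] := orthprojP x Kc.
apply: orthproj_uniq => //; first exact: KA.
by move=> z Kz; rewrite -(adjoint_pairB AB) AB; apply: xp; exact: KB.
Qed.

Lemma orthproj_projector K : closed_subspace K -> projector (orthproj K).
Proof.
move=> Kc; split=> [x y|x].
  have [Kpx xp] := orthprojP x Kc; have [Kpy yp] := orthprojP y Kc.
  rewrite -[in LHS](subrK (orthproj K y) y) -[in RHS](subrK (orthproj K x) x).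
  by rewrite hdotDr hdotDl (hdot_sym0 (yp _ Kpx)) (xp _ Kpy) !add0r.
by apply: orthproj_id => //; case: (orthprojP x Kc).
Qed.

(** With y the component of x orthogonal to ker A, one has B A y = y: both A and
    B are contractions, and <A y, A y> = <y, y> leaves
    |B A y - y|^2 = |B A y|^2 - |y|^2 <= 0. *)
Lemma partial_isometry_adj A B : adjoint_pair A B -> partial_isometry A ->
  forall x, A (B (A x)) = A x.
Proof.
move=> AB Api.
have BA := adjoint_pair_sym AB.
pose K := [set x | A x = 0].
have KE : K = orth (range B).
  apply/seteqP; split=> [x /= Ax _ [y _ <-]|x /= xo].
    by rewrite -AB Ax hdot0l.
  by apply: hdot_inj => z; rewrite AB hdot0l; apply: xo; exists z.
have Kc : closed_subspace K by rewrite KE; exact: orth_closed_subspace.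
have contr x : hdot (A x) (A x) <= hdot x x.
  have [Kp xp] := orthprojP x Kc; set y := x - orthproj K x in xp.
  have Ay : A y = A x by rewrite (adjoint_pairB AB) Kp subr0.
  have xE : x = y + orthproj K x by rewrite subrK.
  rewrite -Ay -[X in X <= _]hdot_norm Api // hdot_norm.
  rewrite {1 2}xE; have := hnormDd (form := hdot) (xp _ Kp) => ->.
  by rewrite lerDl dnorm_ge0.
have contrB y : hdot (B y) (B y) <= hdot y y.
  rewrite -!hdot_norm ler_pXn2r ?nnegrE //.
  have [->|B0] := eqVneq (B y) 0; first by rewrite normr0.
  rewrite -(@ler_pM2r _ `|B y|) ?normr_gt0 // -expr2 hdot_norm BA.
  rewrite (le_trans (real_ler_norm _)) ?realE -?BA ?dnorm_ge0 //.
  rewrite BA (le_trans (hdot_le _ _)) // ler_wpM2l //.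
  exact/norm_le/contr.
move=> x.
have [Kp xp] := orthprojP x Kc; set y := x - orthproj K x in xp.
have <- : A y = A x by rewrite (adjoint_pairB AB) Kp subr0.
clearbody y; congr A; apply/subr0_eq/hdot_eq0/eqP.
rewrite eq_le dnorm_ge0 andbT.
have yy : hdot (A y) (A y) = hdot y y by rewrite -!hdot_norm Api.
rewrite hdotBl !hdotBr (BA (A y) y) -(AB y (A y)) yy.
by rewrite subrr subr0 subr_le0 -yy contrB.
Qed.

End AdjointPairs.

(** * The range projections of a power partial isometry *)

(** A power partial isometry T with its adjoint S. The notion is symmetric in T
    and S ([ppi_pair_sym]), so each result about E_n, P and forward shifts also
    yields the one about F_n, Q and backward shifts. *)
Definition ppi_pair (R : realType) (H : hilbertType R) (T S : H -> H) :=
  adjoint_pair T S /\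
  forall n x, iter n T (iter n S (iter n T x)) = iter n T x.

Lemma ppi_pair_sym (R : realType) (H : hilbertType R) (T S : H -> H) :
  ppi_pair T S -> ppi_pair S T.
Proof.
move=> [TS TST]; split=> [|n x]; first exact: adjoint_pair_sym.
have TSn := adjoint_pair_iter n TS.
apply: hdot_injr => z; rewrite -!TSn -(adjoint_pair_sym TSn) -TSn.
by rewrite TST.
Qed.

Section RangeProjections.
Variables (R : realType) (H : hilbertType R).
Implicit Types (T S : H -> H).

(** The projection onto the range of T^n; with T and S exchanged, it is the
    projection onto the range of S^n. *)
Definition range_proj T S n (x : H) : H := iter n T (iter n S x).

Variables (T S : H -> H) (TS : ppi_pair T S).
Let adjTS n : adjoint_pair (iter n T) (iter n S).
Proof. by apply: adjoint_pair_iter; case: TS. Qed.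

Lemma range_proj_projector n : projector (range_proj T S n).
Proof.
split=> [x y|x]; rewrite /range_proj; last by case: TS => _ ->.
by rewrite adjTS (adjoint_pair_sym (adjTS n)).
Qed.

Lemma range_projSl n x : range_proj T S n.+1 x = T (range_proj T S n (S x)).
Proof. by rewrite /range_proj iterS [iter n.+1 S x]iterSr. Qed.

Lemma range_proj_absorb m k x :
  range_proj T S m (range_proj T S (m + k) x) = range_proj T S (m + k) x.
Proof. by rewrite {2 3}/range_proj iterD /range_proj; case: TS => _ ->. Qed.

Lemma range_proj_absorbr m k x :
  range_proj T S (m + k) (range_proj T S m x) = range_proj T S (m + k) x.
Proof.
have [En _] := range_proj_projector m; have [Em _] := range_proj_projector (m + k).
by apply: hdot_inj => z; rewrite Em En range_proj_absorb -Em.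
Qed.

Lemma range_projM m n x :
  range_proj T S m (range_proj T S n x) = range_proj T S (maxn m n) x.
Proof.
case: (leqP m n) => [mn|/ltnW nm].
  by rewrite -(subnKC mn) range_proj_absorb.
by rewrite -{1 2}(subnKC nm) range_proj_absorbr.
Qed.
End RangeProjections.

Section Commutation.
Variables (R : realType) (H : hilbertType R) (T S : H -> H).
Hypothesis TS : ppi_pair T S.
Let ST := ppi_pair_sym TS.
Let adjTS : adjoint_pair T S. Proof. by case: TS. Qed.

(** The partial isometry T^(n+m) gives T^n (T^m S^m) (S^n T^n) T^m = T^n T^m;
    multiplying by S^n and S^m makes the product of the two projections
    idempotent. *)
Lemma range_proj_comm m n x :
  range_proj T S m (range_proj S T n x) = range_proj S T n (range_proj T S m x).
Proof.
apply: projectors_commute; [exact: range_proj_projector..|move=> {}x].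
rewrite /range_proj; congr (iter n S _); have [_ TST] := TS.
by have := TST (n + m)%N (iter m S x); rewrite {2}(addnC n m) !iterD.
Qed.

(** This and [T_range_projS] carry all the algebra below; their counterparts for
    S are obtained by exchanging T and S. *)
Lemma T_range_proj n x : T (range_proj T S n x) = range_proj T S n.+1 (T x).
Proof.
rewrite range_projSl -[S (T x)]/(range_proj S T 1 x) range_proj_comm.
by have [_ /(_ 1%N (range_proj T S n x)) /= ->] := TS.
Qed.

Lemma T_range_projS n x : T (range_proj S T n.+1 x) = range_proj S T n (T x).
Proof.
rewrite range_projSl -[T (S _)]/(range_proj T S 1 _) range_proj_comm.
by have [_ /(_ 1%N x) /= TST] := TS; rewrite {2}/range_proj /= TST.
Qed.

End Commutation.

(** * The projections P and Q *)

Section LimitProjections.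
Variables (R : realType) (H : hilbertType R) (T S : H -> H).
Hypothesis TS : ppi_pair T S.
Let ST := ppi_pair_sym TS.
Let adjTS : adjoint_pair T S. Proof. by case: TS. Qed.
Let adjST : adjoint_pair S T. Proof. by case: ST. Qed.

Let K : set H := \bigcap_(n in [set n | (1 <= n)%N]) range (iter n T).

Let KP x : K x <-> forall n, range_proj T S n x = x.
Proof.
split=> [Kx [//|n]|Ex n _]; last first.
  by exists (iter n S x); rewrite // -[LHS]/(range_proj T S n x).
have [//|y _ <-] := Kx n.+1.
by rewrite /range_proj; case: TS => _ ->.
Qed.

Let Kc : closed_subspace K.
Proof.
have -> : K = orth [set y - range_proj T S n y | n in setT & y in setT].
  apply/seteqP; split=> [x /KP Ex _ [n _ [y _ <-]]|x xo].
    have [EE _] := range_proj_projector TS n.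
    by rewrite hdotBr -EE Ex subrr.
  apply/KP => n; have [EE _] := range_proj_projector TS n.
  apply: hdot_inj => z; apply/esym/subr0_eq; rewrite EE -hdotBr; apply: xo.
  by exists n => //; exists z.
exact: orth_closed_subspace.
Qed.

Lemma proj_ranges_projector : projector (proj_ranges T).
Proof. exact: orthproj_projector. Qed.

Lemma proj_ranges_fix x : proj_ranges T x = x <-> forall n, range_proj T S n x = x.
Proof.
rewrite -KP; split=> [<-|]; last exact: orthproj_id.
by case: (orthprojP x Kc).
Qed.

Lemma range_proj_proj_ranges n x :
  range_proj T S n (proj_ranges T x) = proj_ranges T x.
Proof.
by move: n; apply/proj_ranges_fix; case: proj_ranges_projector.
Qed.

Lemma proj_ranges_comm (A B : H -> H) : adjoint_pair A B ->
  (forall x, (forall n, range_proj T S n x = x) ->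
     forall n, range_proj T S n (A x) = A x) ->
  (forall x, (forall n, range_proj T S n x = x) ->
     forall n, range_proj T S n (B x) = B x) ->
  forall x, proj_ranges T (A x) = A (proj_ranges T x).
Proof.
by move=> AB KA KB; apply: (orthproj_comm Kc AB) => x /KP Kx; apply/KP; auto.
Qed.

Let KT x : (forall n, range_proj T S n x = x) ->
  forall n, range_proj T S n (T x) = T x.
Proof. by move=> Kx [//|n]; rewrite -T_range_proj // Kx. Qed.

Let KS x : (forall n, range_proj T S n x = x) ->
  forall n, range_proj T S n (S x) = S x.
Proof. by move=> Kx n; rewrite -(T_range_projS ST) Kx. Qed.

Lemma proj_ranges_T x : proj_ranges T (T x) = T (proj_ranges T x).
Proof. exact: proj_ranges_comm. Qed.

Lemma proj_ranges_S x : proj_ranges T (S x) = S (proj_ranges T x).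
Proof. exact: proj_ranges_comm. Qed.

Lemma proj_ranges_range_proj n x :
  proj_ranges T (range_proj T S n x) = proj_ranges T x.
Proof.
have [PP _] := proj_ranges_projector; have [EE _] := range_proj_projector TS n.
by apply: hdot_inj => z; rewrite PP EE range_proj_proj_ranges PP.
Qed.

Lemma proj_ranges_range_proj_comm n x :
  proj_ranges T (range_proj S T n x) = range_proj S T n (proj_ranges T x).
Proof.
have [FF _] := range_proj_projector ST n.
apply: (proj_ranges_comm FF) => y Ey m; by rewrite range_proj_comm // Ey.
Qed.

End LimitProjections.

Section LimitProjectionsCommute.
Variables (R : realType) (H : hilbertType R) (T S : H -> H).
Hypothesis TS : ppi_pair T S.
Let ST := ppi_pair_sym TS.

Lemma proj_ranges_commute x :
  proj_ranges S (proj_ranges T x) = proj_ranges T (proj_ranges S x).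
Proof.
have [PP _] := proj_ranges_projector TS.
by apply: (proj_ranges_comm ST PP) => y Fy n;
  rewrite -(proj_ranges_range_proj_comm TS) Fy.
Qed.
End LimitProjectionsCommute.

(** * Corners and their antidiagonal sums *)

Section Gaps.
Variables (R : realType) (H : hilbertType R) (T S : H -> H).
Hypothesis TS : ppi_pair T S.
Let ST := ppi_pair_sym TS.
Let adjTS : adjoint_pair T S. Proof. by case: TS. Qed.

(** The pair of operators is an argument because the gaps of both families, the
    E_n and the F_n, enter every corner. *)
Definition gap (A B : H -> H) n : H -> H :=
  range_proj A B n \- range_proj A B n.+1.

Lemma gap_projector n : projector (gap T S n).
Proof.
apply: projector_sub => [||x]; [exact: range_proj_projector..|].
by rewrite range_projM // maxnE subSnn addn1.
Qed.

Lemma range_proj_gap m n x : (m <= n)%N ->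
  range_proj T S m (gap T S n x) = gap T S n x.
Proof.
have [EE _] := range_proj_projector TS m.
by move=> mn; rewrite /gap /= (adjoint_pairB EE) !range_projM // !(maxn_idPr _) // ltnW.
Qed.

Lemma range_proj_gap0 m n x : (n < m)%N -> range_proj T S m (gap T S n x) = 0.
Proof.
have [EE _] := range_proj_projector TS m.
move=> nm; rewrite /gap /= (adjoint_pairB EE) !range_projM //.
by rewrite !(maxn_idPl _) // ?subrr // ltnW.
Qed.

Lemma gap_gap0 m n x : m != n -> gap T S m (gap T S n x) = 0.
Proof.
rewrite /gap /=; case: ltngtP => // mn _.
  by rewrite !range_proj_gap ?subrr // ltnW.
by rewrite !range_proj_gap0 ?subrr // ltnW.
Qed.

Lemma gap_comm m n x : gap T S m (gap S T n x) = gap S T n (gap T S m x).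
Proof.
rewrite /gap /= !(adjoint_pairB (proj1 (range_proj_projector TS _))).
rewrite !(adjoint_pairB (proj1 (range_proj_projector ST _))) !(range_proj_comm TS).
by rewrite !opprD addrACA.
Qed.
End Gaps.

Section Corners.
Variables (R : realType) (H : hilbertType R) (T S : H -> H).
Hypothesis TS : ppi_pair T S.
Let ST := ppi_pair_sym TS.
Let adjTS : adjoint_pair T S. Proof. by case: TS. Qed.

Lemma T_gap n x : T (gap T S n x) = gap T S n.+1 (T x).
Proof. by rewrite /gap /= (adjoint_pairB adjTS) !T_range_proj. Qed.

Lemma T_gapS n x : T (gap S T n.+1 x) = gap S T n (T x).
Proof. by rewrite /gap /= (adjoint_pairB adjTS) !T_range_projS. Qed.

Lemma T_gap0 x : T (gap S T 0 x) = 0.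
Proof.
rewrite /gap /= (adjoint_pairB adjTS); have [_ /(_ 1%N x) /= h] := TS.
by rewrite /range_proj /= h subrr.
Qed.

Lemma gap0_T x : gap T S 0 (T x) = 0.
Proof.
by rewrite /gap /= /range_proj /=; have [_ /(_ 1%N x) /= ->] := TS; rewrite subrr.
Qed.

Definition corner a b : H -> H := gap T S a \o gap S T b.

Lemma corner_projector a b : projector (corner a b).
Proof.
apply: projector_comp => [||x]; [exact: gap_projector..|exact: gap_comm].
Qed.

Lemma corner_corner0 a b c e x : (a != c) || (b != e) ->
  corner a b (corner c e x) = 0.
Proof.
rewrite /corner /= => /orP[ac|be].
  by rewrite -!(gap_comm TS) gap_gap0 // (adjoint_pair0 (proj1 (gap_projector ST _))).
rewrite (gap_comm TS c e) gap_gap0 // (adjoint_pair0 (proj1 (gap_projector TS _))) //.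
Qed.

Lemma T_corner a b x : T (corner a b.+1 x) = corner a.+1 b (T x).
Proof. by rewrite /corner /= T_gap T_gapS. Qed.

Lemma T_corner0 a x : T (corner a 0 x) = 0.
Proof. by rewrite /corner /= gap_comm // T_gap0. Qed.

Lemma corner0_T b x : corner 0 b (T x) = 0.
Proof.
by rewrite /corner /= gap_comm // gap0_T (adjoint_pair0 (proj1 (gap_projector ST _))).
Qed.

(** The range of this projection is the summand H_p with p = k + 1. *)
Definition antidiag k (x : H) : H := \sum_(a < k.+1) corner a (k - a) x.

Lemma antidiag_projector k : projector (antidiag k).
Proof.
apply: projector_sum => [a|a b x ab]; first exact: corner_projector.
by rewrite corner_corner0 // ab.
Qed.

(** T maps each corner to the next one along the antidiagonal, kills the last
    one, and nothing in the range of T reaches the first one. *)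
Lemma T_antidiag k x : T (antidiag k x) = antidiag k (T x).
Proof.
rewrite /antidiag (adjoint_pair_sum adjTS) big_ord_recr [RHS]big_ord_recl /=.
rewrite subnn T_corner0 corner0_T addr0 add0r; apply: eq_bigr => a _.
by rewrite -(subnSK (ltn_ord a)) T_corner.
Qed.

Lemma antidiag_antidiag0 k l x : k != l -> antidiag k (antidiag l x) = 0.
Proof.
move=> kl; rewrite /antidiag big1 // => a _.
rewrite (adjoint_pair_sum (proj1 (corner_projector _ _))) big1 // => b _.
apply: corner_corner0; apply: contra_neqT kl.
rewrite negb_or !negbK => /andP[/eqP ab /eqP h].
by rewrite -(subnKC (ltnSE (ltn_ord a))) h ab subnKC // -ltnS.
Qed.

Lemma corner_antidiag a b x : corner a b (antidiag (a + b) x) = corner a b x.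
Proof.
have lt_a : (a < (a + b).+1)%N by rewrite ltnS leq_addr.
rewrite /antidiag (adjoint_pair_sum (proj1 (corner_projector _ _))).
rewrite (bigD1 (Ordinal lt_a)) //= addKn big1 ?addr0 => [|c ca].
  by have [_ ->] := corner_projector a b.
by rewrite corner_corner0 // eq_sym ca.
Qed.

Lemma antidiag_eq0 k x : (forall a, (a <= k)%N -> corner a (k - a) x = 0) ->
  antidiag k x = 0.
Proof. by move=> h; rewrite /antidiag big1 // => a _; rewrite h // -ltnS. Qed.

(** H_p is given as the set of sums of p vectors, one from each corner; as the
    corners are mutually orthogonal, such a sum is fixed by [antidiag k]. *)
Lemma antidiag_range k : range (antidiag k) =
  [set v | exists h : nat -> H, v = \sum_(a < k.+1) corner a (k - a) (h a)].
Proof.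
apply/seteqP; split=> [_ [x _ <-]|_ [h ->]]; first by exists (fun=> x).
exists (\sum_(a < k.+1) corner a (k - a) (h a)) => //.
apply: eq_bigr => a _.
rewrite (adjoint_pair_sum (proj1 (corner_projector _ _))) (bigD1 a) //=.
rewrite big1 ?addr0 => [|b ba]; first by have [_ ->] := corner_projector a (k - a).
by rewrite corner_corner0 // eq_sym ba.
Qed.

Lemma corner_proj_ranges a b x : corner a b (proj_ranges T x) = 0.
Proof.
by rewrite /corner /= gap_comm // /gap /= !range_proj_proj_ranges // subrr
  !(adjoint_pair0 (proj1 (range_proj_projector ST _))) subrr.
Qed.

End Corners.

Section CornerSymmetry.
Variables (R : realType) (H : hilbertType R) (T S : H -> H).
Hypothesis TS : ppi_pair T S.
Let ST := ppi_pair_sym TS.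

Lemma corner_swap a b x : corner T S a b x = corner S T b a x.
Proof. exact: gap_comm. Qed.

Lemma S_antidiag k x : S (antidiag T S k x) = antidiag T S k (S x).
Proof.
have [DD _] := antidiag_projector TS k; have [adjTS _] := TS.
have adjST := adjoint_pair_sym adjTS.
by apply: hdot_inj => z; rewrite adjST DD [RHS]DD adjST T_antidiag.
Qed.

Lemma corner_proj_ranges2 a b x : corner T S a b (proj_ranges S x) = 0.
Proof. by rewrite corner_swap corner_proj_ranges. Qed.

(** Each y = gap T S a x has no component in any gap of the F_b, so all F_b fix
    it and Q y = y; but Q commutes with the gap and kills x. *)
Lemma decomposition_total x :
  proj_ranges T x = 0 -> proj_ranges S x = 0 ->
  (forall k, antidiag T S k x = 0) -> x = 0.
Proof.
move=> Px Qx Dx.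
have gap0 a : gap T S a x = 0.
  set y := gap T S a x.
  have corner0 b : gap S T b y = 0.
    rewrite /y -gap_comm // -[LHS]/(corner T S a b x) -corner_antidiag // Dx.
    exact: (adjoint_pair0 (proj1 (corner_projector TS a b))).
  have fy b : range_proj S T b y = y.
    elim: b => [//|b IH]; rewrite -[RHS]IH; apply/esym/subr0_eq.
    exact: corner0.
  have <- : proj_ranges S y = y by apply/(proj_ranges_fix ST).
  have [QQ _] := proj_ranges_projector ST.
  rewrite /y /gap /= (adjoint_pairB QQ) !(proj_ranges_range_proj_comm ST) Qx.
  by rewrite !(adjoint_pair0 (proj1 (range_proj_projector TS _))) subrr.
rewrite -Px; apply/esym/(proj_ranges_fix TS).
by elim=> [//|n IH]; rewrite -[RHS]IH; apply/esym/subr0_eq; exact: gap0.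
Qed.
End CornerSymmetry.

(** * Closed subspaces as Hilbert spaces *)

Section SubHilbert.
Variables (R : realType) (H : hilbertType R) (K : set H).
Hypothesis Kc : closed_subspace K.

Definition subspace_pred of closed_subspace K : {pred H} := fun x => `[< K x >].
Local Notation Kp := (subspace_pred Kc).

Fact subspace_submod_closed : submod_closed Kp.
Proof.
have [[K0 Kl] _] := Kc.
split=> [|a x y /asboolP Kx /asboolP Ky]; apply/asboolP => //.
exact: Kl.
Qed.

HB.instance Definition _ := GRing.isSubmodClosed.Build R[i] H
  Kp subspace_submod_closed.

Record sub_hilbert := SubHilbert { sub_val : H ; _ : sub_val \in Kp }.
HB.instance Definition _ := [isSub for sub_val].
HB.instance Definition _ := [Choice of sub_hilbert by <:].
HB.instance Definition _ := [SubChoice_isSubLmodule of sub_hilbert by <:].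
Implicit Types x y : sub_hilbert.

Definition sub_dot x y : R[i] := hdot (sub_val x) (sub_val y).

Let dotDl y : zmod_morphism (sub_dot^~ y).
Proof. by move=> x x'; exact: hdotBl. Qed.

Let dotDr x : zmod_morphism (sub_dot x).
Proof. by move=> y y'; exact: hdotBr. Qed.

Let dotZl y : scalable_for *%R (sub_dot^~ y).
Proof. by move=> a x; exact: hdotZl. Qed.

Let dotZr x : scalable_for (Num.conj \; *%R) (sub_dot x).
Proof. by move=> a y; exact: hdotZr. Qed.

HB.instance Definition _ := @isBilinear.Build _ _ _ _ _ _ sub_dot
  dotDl dotDr dotZl dotZr.

Let dotC x y : sub_dot x y = (-1) ^+ false * (sub_dot y x)^*.
Proof. by rewrite expr0 mul1r /sub_dot hdotC. Qed.

HB.instance Definition _ :=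
  @isHermitianSesquilinear.Build _ _ false Num.conj sub_dot dotC.

Let dot_gt0 x : x != 0 -> 0 < sub_dot x x.
Proof. by move=> x0; rewrite dnorm_gt0. Qed.

HB.instance Definition _ := @isDotProduct.Build _ _ sub_dot dot_gt0.

Let d : {dot sub_hilbert for Num.conj} := sub_dot.
HB.instance Definition _ := Lmodule_isNormed.Build R[i] sub_hilbert
  (dot_norm_triangle d) (dot_normZ d) (@dot_norm_eq0 _ _ d).

Let normE x : `|x| ^+ 2 = sub_dot x x.
Proof. exact: sqrtCK. Qed.

Lemma sub_normE x : `|x| = `|sub_val x|.
Proof.
apply/eqP; rewrite -(@eqrXn2 _ 2) ?normr_ge0 //.
by rewrite normE hdot_norm.
Qed.

Let complete (F : set_system sub_hilbert) :
  ProperFilter F -> cauchy F -> cvg F.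
Proof.
move=> FF Fc.
have Gc : cauchy (sub_val @ F).
  apply/cauchyP => e e0; have [x Fx] := (cauchyP F).1 Fc e e0.
  exists (sub_val x); apply: (@filterS _ F _ _ _ _ Fx) => y; rewrite -!ball_normE /=.
  by rewrite sub_normE.
have /cvg_ex [l Gl] : cvg (sub_val @ F) by exact: cauchy_cvg.
have Kl : l \in Kp.
  apply/asboolP; apply: (@closed_cvg _ _ F _ sub_val K (proj2 Kc) _ l) => //.
  by apply: nearW => x; apply/asboolP/(valP x).
apply/cvg_ex; exists (SubHilbert Kl); apply/cvgrPdist_le => e e0.
move/cvgrPdist_le: Gl => /(_ _ e0); apply: filterS => x.
by rewrite sub_normE.
Qed.

HB.instance Definition _ := Uniform_isComplete.Build sub_hilbert complete.
HB.instance Definition _ := NormedModule_isHilbert.Build R sub_hilbert normE.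

Lemma sub_hdotE x y : hdot x y = hdot (sub_val x) (sub_val y).
Proof. by []. Qed.
Lemma sub_valP x : K (sub_val x).
Proof. exact/asboolP/(valP x). Qed.
Definition to_sub (x : H) (Kx : K x) : sub_hilbert := SubHilbert (asboolT Kx).

Lemma sub_val_linear : linear sub_val.
Proof. by []. Qed.
End SubHilbert.

(** * Tensor products realised inside a Hilbert space *)

Section TensorModel.
Variables (R : realType) (L : hilbertType R) (I : eqType) (b : I -> L).

(** The last clause is the Bessel inequality in the form in which it is used:
    the coefficients of a vector along any orthogonal family of constant norm
    form an element of L, with a uniform bound. *)
Definition hilbert_basis :=
  [/\ forall i j, hdot (b i) (b j) = (i == j)%:R,
      forall z, (forall i, hdot z (b i) = 0) -> z = 0 &
      forall (H : hilbertType R) (u : I -> H) (r : R[i]),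
        (forall i j, hdot (u i) (u j) = (i == j)%:R * r) ->
        exists c : H -> L, [/\ linear c, bounded_op c &
          forall w i, hdot (c w) (b i) = hdot w (u i)]].

Hypothesis bP : hilbert_basis.

Let b_inj x y : (forall i, hdot x (b i) = hdot y (b i)) -> x = y.
Proof.
by case: bP => _ b0 _ xy; apply/subr0_eq/b0 => i; rewrite hdotBl xy subrr.
Qed.

(** Let c m w be the element of L with coordinates <w, e_i m>, and V m the adjoint
    of c m, so that V m x plays the part of the sum of the x_i e_i m. Then
    c m' (V m x) = <m, m'> x, which is the inner product rule of a tensor product.
    An identity X (t x m) = t (A x) m between operators with adjoints is
    equivalent to its adjoint form, which is tested on the basis. *)
Lemma tensor_model (E M : hilbertType R) (e : I -> M -> E) :
  (forall i, linear (e i)) ->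
  (forall i j m m', hdot (e i m) (e j m') = (i == j)%:R * hdot m m') ->
  (forall w, (forall i m, hdot w (e i m) = 0) -> w = 0) ->
  exists t : {bilinear L -> M -> E},
    [/\ forall x x' m m', hdot (t x m) (t x' m') = hdot x x' * hdot m m',
        closed_span [set t x m | x in setT & m in setT] = setT,
        forall i m, t (b i) m = e i m &
        forall (A A' : L -> L) (X X' : E -> E),
          adjoint_pair A A' -> adjoint_pair X X' ->
          (forall i m, X (e i m) = t (A (b i)) m) ->
          forall x m, X (t x m) = t (A x) m].
Proof.
move=> el eo e0; have [bo _ bc] := bP.
have /choice[c cP] (m : M) := bc E (e^~ m) (hdot m m)
  (fun i j => eo i j m m).
have cb m w i : hdot (c m w) (b i) = hdot w (e i m) by case: (cP m).
pose V m := adjoint (c m).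
have cV m : adjoint_pair (c m) (V m).
  have [cl [N cN] _] := cP m.
  exact: adjoint_pairP cN.
have Vc m := adjoint_pair_sym (cV m).
have Vb m i : V m (b i) = e i m.
  by apply: hdot_injr => w; rewrite -cV cb.
have ce m m' j : c m' (e j m) = hdot m m' *: b j.
  by apply: b_inj => i; rewrite cb eo hdotZl bo mulrC.
have cVE m m' x : c m' (V m x) = hdot m m' *: x.
  apply: b_inj => j; rewrite cb Vc ce hdotZr hdotZl; congr (_ * _).
  by rewrite -hdotC.
have cD a m m' w : c (a *: m + m') w = a^* *: c m w + c m' w.
  by apply: b_inj => i; rewrite cb el !(hdotDr, hdotZr, hdotDl, hdotZl) !cb.
have VD a m m' x : V (a *: m + m') x = a *: V m x + V m' x.
  apply: hdot_injr => w.
  by rewrite -cV cD hdotDr hdotDl hdotZl hdotZr !cV.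
pose t0 x m := V m x.
have tl m : {morph t0^~ m : x y / x - y >-> x - y}.
  by move=> x y; exact: adjoint_pairB (Vc m) _ _.
have tr x : {morph t0 x : x y / x - y >-> x - y}.
  move=> m m'; rewrite /t0 addrC -scaleN1r VD.
  by rewrite scaleN1r addrC.
have tZl m : scalable_for *:%R (t0^~ m).
  by move=> a x; exact: adjoint_pairZ (Vc m) _ _.
have V0 x : V 0 x = 0.
  by have := tr x 0 0; rewrite /t0 !subrr.
have tZr x : scalable_for *:%R (t0 x).
  by move=> a m; rewrite /t0 -[a *: m]addr0 VD V0 addr0.
pose t : {bilinear L -> M -> E} := HB.pack t0
  (@isBilinear.Build _ L M E *:%R *:%R t0 tl tr tZl tZr).
exists t; split=> [x x' m m'||i m|A A' X X' AA XX Xe x m].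
- by rewrite -[t x m]/(V m x) -[t x' m']/(V m' x') -cV cVE hdotZl mulrC.
- apply: closed_span_eqT => w wo; apply: e0 => i m.
  by apply: wo; exists (b i) => //; exists m => //; exact: Vb.
- exact: Vb.
- rewrite -[t x m]/(V m x) -[t (A x) m]/(V m (A x)).
  apply: hdot_inj => w; rewrite XX !Vc AA; congr (hdot x _).
  apply: b_inj => i; rewrite cb (adjoint_pair_sym XX) Xe -[t _ m]/(V m _).
  by rewrite -cV (adjoint_pair_sym AA).
Qed.

End TensorModel.

(** [tensor_model] for a reducing subspace K of H and a closed multiplicity space
    N, with maps e_i : N -> K that come from operators of H. *)
Section RestrictedTensorModel.
Variables (R : realType) (L : hilbertType R) (I : eqType) (b : I -> L).
Hypothesis bP : hilbert_basis b.
Variables (H : hilbertType R) (T S : H -> H) (K N : set H).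
Hypotheses (TS : adjoint_pair T S) (Tb : bounded_op T).
Hypotheses (Kc : closed_subspace K) (Nc : closed_subspace N).
Hypotheses (TK : forall x, K x -> K (T x)) (SK : forall x, K x -> K (S x)).
Variables (e e' : I -> H -> H).
Hypothesis ee' : forall i, adjoint_pair (e i) (e' i).
Hypothesis eK : forall i m, N m -> K (e i m).
Hypothesis eo : forall i j m m', N m -> N m' ->
  hdot (e i m) (e j m') = (i == j)%:R * hdot m m'.
Hypothesis e0 : forall w, K w -> (forall i m, N m -> hdot w (e i m) = 0) -> w = 0.
Variables (A A' : L -> L).
Hypothesis AA' : adjoint_pair A A'.
Hypothesis Ae : forall i,
  (exists j, A (b i) = b j /\ forall m, N m -> T (e i m) = e j m) \/
  (A (b i) = 0 /\ forall m, N m -> T (e i m) = 0).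

Lemma restricted_tensor_model :
  unitarily_equivalent_to_tensor (sub_hilbert Nc) T K A.
Proof.
pose E : hilbertType R := sub_hilbert Kc.
pose f i (m : sub_hilbert Nc) : E := to_sub Kc (eK i (sub_valP m)).
have [|i j m m'|w w0|t [tdot tspan tb tX]] :=
    @tensor_model _ L I b bP E (sub_hilbert Nc) f.
- move=> i a m m'; apply: val_inj => /=.
  exact: (adjoint_pair_linear (ee' i)).
- by rewrite !sub_hdotE eo //; exact: sub_valP.
- apply: val_inj; apply: e0 => [|i m Nm]; first exact: sub_valP.
  by have := w0 i (to_sub Nc Nm).
pose X0 (x : E) : E := to_sub Kc (TK (sub_valP x)).
pose X0' (x : E) : E := to_sub Kc (SK (sub_valP x)).
have XX : adjoint_pair X0 X0' by move=> x y; rewrite !sub_hdotE /= TS.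
have X0l : linear X0 := adjoint_pair_linear XX.
pose X : {linear E -> E} := HB.pack X0 (GRing.isLinear.Build _ _ _ _ X0 X0l).
pose W : {linear E -> H} := HB.pack (fun x : E => sub_val x)
  (GRing.isLinear.Build _ _ _ _ (fun x : E => sub_val x) (@sub_val_linear _ _ _ Kc)).
exists (HilbertTensor tdot tspan), X; split.
  split=> [|x m].
    have [M TM] := Tb; exists M => x.
    by rewrite !sub_normE; exact: TM.
  apply: (tX A A' X0 X0') => // i {}m.
  have [[j [-> Te]]|[-> Te]] := Ae i.
    by rewrite tb; apply: val_inj; rewrite /= Te //; exact: sub_valP.
  by rewrite linear0l; apply: val_inj; rewrite /= Te //; exact: sub_valP.
exists W; split=> //; split=> [x y _ _ //|].
apply/seteqP; split=> [_ [x _ <-]|x Kx]; first exact: sub_valP.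
by exists (to_sub Kc Kx).
Qed.
End RestrictedTensorModel.

(** * The standard bases of C^p and of the sequence space *)

Section Bessel.
Variables (R : realType) (H : hilbertType R) (I : eqType) (u : I -> H) (r : R[i]).
Hypothesis uP : forall i j, hdot (u i) (u j) = (i == j)%:R * r.

(** For y the sum of the <w, u_i> u_i over s and sigma the left-hand side, one has
    <w, y> = sigma and <y, y> = r sigma, and the Cauchy-Schwarz inequality reads
    sigma^2 <= <w, w> r sigma. *)
Lemma bessel s w : uniq s ->
  (\sum_(i <- s) sqmod (hdot w (u i)))%:C%C <= `|r| * hdot w w.
Proof.
move=> us; set sigma := \sum_(i <- s) _.
have sigma0 : 0 <= sigma by apply: sumr_ge0 => i _; exact: sqmod_ge0.
pose y := \sum_(i <- s) hdot w (u i) *: u i.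
have yu j : j \in s -> hdot y (u j) = hdot w (u j) * r.
  move=> js; rewrite hdot_suml (bigD1_seq j) //= hdotZl uP eqxx mul1r.
  rewrite big1 ?addr0 // => i /negPf ij.
  by rewrite hdotZl uP ij mul0r mulr0.
have sigmaE : sigma%:C%C = \sum_(i <- s) (hdot w (u i))^* * hdot w (u i).
  rewrite rmorph_sum; apply: eq_bigr => i _ /=.
  by rewrite -normc_sqmod normCK mulrC.
have wy : hdot w y = sigma%:C%C.
  rewrite sigmaE hdot_sumr; apply: eq_bigr => i _.
  by rewrite hdotZr.
have yy : hdot y y = r * sigma%:C%C.
  rewrite {2}/y hdot_sumr sigmaE mulr_sumr !big_seq.
  by apply: eq_bigr => i si; rewrite hdotZr yu // mulrA mulrC.
have [->|s0] := eqVneq sigma 0; first by rewrite mulr_ge0 ?dnorm_ge0.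
have sp : 0 < sigma%:C%C by rewrite ltcR lt_def s0.
have := dot_CauchySchwarz hdot w y.
rewrite wy yy (ger0_norm (ltW sp)) expr2 mulrA ler_pM2r // mulrC => h.
apply: (le_trans h); apply: ler_wpM2r; first exact: dnorm_ge0.
apply: real_ler_norm; rewrite realE.
by have := dnorm_ge0 hdot y; rewrite yy pmulr_lge0 // => ->.
Qed.

Lemma bounded_op_bessel (L : hilbertType R) (c : H -> L) :
  (forall w, hdot (c w) (c w) <= `|r| * hdot w w) -> bounded_op c.
Proof.
move=> cr; exists (Num.sqrt (complex.Re `|r|)) => w.
have rE : `|r| = (complex.Re `|r|)%:C%C by rewrite RRe_real // normr_real.
have r0 : 0 <= complex.Re `|r| by rewrite -lecR -rE; exact: normr_ge0.
rewrite -(@ler_pXn2r _ 2) ?nnegrE ?mulr_ge0 ?normr_ge0 ?lecR ?sqrtr_ge0 //.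
rewrite exprMn !hdot_norm -rmorphXn sqr_sqrtr //=; rewrite -rE cr.
Qed.
End Bessel.

Section CvecBasis.
Variables (R : realType) (p : nat).

Definition cvec_basis (i : 'I_p) : Cvec R p := delta_mx i 0.

Lemma cvec_hdot_basis (x : Cvec R p) i : hdot x (cvec_basis i) = x i 0.
Proof.
rewrite -[LHS]/(Cvec_dot _ _) /Cvec_dot (bigD1 i) //= big1 => [|j ji].
  by rewrite mxE !eqxx /= conjC1 mulr1 addr0.
by rewrite mxE (negPf ji) /= conjC0 mulr0.
Qed.

Lemma cvec_basisP : hilbert_basis cvec_basis.
Proof.
split=> [i j|z z0|H u r uP].
- by rewrite cvec_hdot_basis mxE eqxx andbT eq_sym.
- by apply/matrixP => i j; rewrite ord1 -cvec_hdot_basis z0 mxE.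
exists (fun w => \col_i hdot w (u i)); split=> [a x y||w i].
- by apply/matrixP => i j; rewrite !mxE hdotDl hdotZl.
- apply: (@bounded_op_bessel _ _ r) => w.
  rewrite -[leLHS]/(Cvec_dot _ _) /Cvec_dot.
  apply: le_trans (bessel uP w (index_enum_uniq 'I_p)).
  rewrite rmorph_sum; apply: ler_sum => i _ /=.
  by rewrite !mxE -normCK normc_sqmod.
- by rewrite cvec_hdot_basis mxE.
Qed.

Lemma truncated_shift_adjoint :
  adjoint_pair (@truncated_shift R p)
    (fun y => (\matrix_(i < p, j < p) (j == i.+1 :> nat)%:R : 'M[R[i]]_p) *m y).
Proof.
move=> x y; rewrite -[LHS]/(Cvec_dot _ _) -[RHS]/(Cvec_dot _ _) /Cvec_dot.
rewrite /truncated_shift.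
under eq_bigr do rewrite mxE mulr_suml.
under [RHS]eq_bigr do rewrite mxE rmorph_sum mulr_sumr.
rewrite exchange_big; apply: eq_bigr => i _; apply: eq_bigr => j _.
by rewrite !mxE rmorphM rmorph_nat mulrCA mulrA.
Qed.

Lemma truncated_shift_basis (i : 'I_p) :
  (forall j : 'I_p, j = i.+1 :> nat ->
     truncated_shift (cvec_basis i) = cvec_basis j) /\
  (i.+1 = p -> truncated_shift (cvec_basis i) = 0).
Proof.
have E k l : truncated_shift (cvec_basis i) k l = (k == i.+1 :> nat)%:R.
  rewrite mxE (bigD1 i) //= big1 => [|j ji].
    by rewrite !mxE !eqxx ord1 /= mulr1 addr0.
  by rewrite !mxE (negPf ji) mulr0.
split=> [j ji|ip]; apply/matrixP => k l; rewrite E.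
  by rewrite mxE ord1 eqxx andbT -ji.
by rewrite mxE ip (ltn_eqF (ltn_ord k)).
Qed.
End CvecBasis.

Section Ell2Basis.
Variable R : realType.

Lemma csum_single (u : nat -> R[i]) (n : nat) : (forall k, k != n -> u k = 0) ->
  csum u = u n.
Proof.
move=> u0; rewrite /csum.
have S (f : nat -> R) : (forall k, k != n -> f k = 0) -> limn (series f) = f n.
  move=> f0; apply: lim_near_cst => //; exists n.+1 => // m /= nm.
  rewrite /series /= (bigD1_seq n) ?iota_uniq ?mem_index_iota //=.
  by rewrite big1 ?addr0.
by rewrite !S => [|k kn|k kn]; [case: (u n)|rewrite u0..].
Qed.

Lemma csum_shift (u : nat -> R[i]) : csummable u -> u 0 = 0 ->
  csum u = csum (fun n => u n.+1).
Proof.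
move=> [ur ui] u0; rewrite /csum.
have S (f : nat -> R) : cvgn (series f) -> f 0 = 0 ->
    limn (series f) = limn (series (fun n => f n.+1)).
  move=> cf f0; apply/esym/cvg_lim => //.
  have -> : series (fun n => f n.+1) = (fun n => series f n.+1).
    by apply/funext => n; rewrite /series /= big_nat_recl //= f0 add0r.
  by rewrite cvg_shiftS.
by congr (_ +i* _)%C; apply: S; rewrite // u0.
Qed.

Lemma ell2_mem (x : nat -> R[i]) (M : R) :
  (forall n, \sum_(i <- index_iota 0 n) sqmod (x i) <= M) -> x \in @ell2_pred R.
Proof.
move=> xM; apply/asboolP; apply: nondecreasing_is_cvgn.
  by apply: nondecreasing_series => n _ _; exact: sqmod_ge0.
by exists M => _ [n _ <-]; exact: xM.
Qed.

Fact ell2_basis_subproof n : (fun k => (k == n)%:R) \in @ell2_pred R.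
Proof.
apply: (@ell2_mem _ 1) => N; have [nN|nN] := boolP (n \in index_iota 0 N).
  rewrite (bigD1_seq n) ?iota_uniq //= big1 => [|k /negPf->].
    by rewrite eqxx sqmodE /= expr1n expr0n !addr0.
  exact: sqmod0.
rewrite big_seq big1 => [|k kN]; first exact: ler01.
by case: eqP => [kn|_]; [rewrite -kn kN in nN|exact: sqmod0].
Qed.

Definition ell2_basis n : ell2 R := Ell2 (ell2_basis_subproof n).

Lemma ell2_hdot_basis (x : ell2 R) n : hdot x (ell2_basis n) = x n.
Proof.
rewrite -[LHS]/(ell2_dot _ _) /ell2_dot (@csum_single _ n) => [|k /negPf kn] /=.
  by rewrite eqxx conjC1 mulr1.
by rewrite kn conjC0 mulr0.
Qed.

Lemma ell2_hdotxx_le (x : ell2 R) (M : R) :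
  (forall n, \sum_(i <- index_iota 0 n) sqmod (x i) <= M) -> hdot x x <= M%:C%C.
Proof.
move=> xM; rewrite -[leLHS]/(ell2_dot _ _) /ell2_dot /csum.
have -> : (fun n => complex.Im (x n * (x n)^*)) = cst 0.
  by apply/funext => n; rewrite -normCK normc_sqmod.
have -> : (fun n => complex.Re (x n * (x n)^*)) = (fun n => sqmod (x n)).
  by apply/funext => n; rewrite -normCK normc_sqmod.
have -> : limn (series (cst 0 : nat -> R)) = 0.
  apply: lim_near_cst => //; apply: nearW => n.
  by rewrite /series /= big1.
rewrite -[leLHS]/((_ : R)%:C%C) lecR.
have /asboolP cx := valP x.
by apply: limr_le => //; apply: nearW => n; exact: xM.
Qed.

Lemma ell2_basisP : hilbert_basis ell2_basis.
Proof.
split=> [i j|z z0|H u r uP].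
- by rewrite ell2_hdot_basis /= eq_sym.
- by apply/val_inj/funext => n; have := z0 n; rewrite ell2_hdot_basis.
have rE : `|r| = (complex.Re `|r|)%:C%C by rewrite RRe_real // normr_real.
have le w n : \sum_(i <- index_iota 0 n) sqmod (hdot w (u i)) <=
    complex.Re `|r| * sqnorm w.
  by rewrite -lecR rmorphM /= -rE sqnormE bessel // iota_uniq.
pose c w : ell2 R := Ell2 (ell2_mem (le w)).
exists c; split=> [a x y||w i].
- by apply/val_inj/funext => n /=; rewrite hdotDl hdotZl.
- apply: (@bounded_op_bessel _ _ r) => w.
  apply: le_trans (@ell2_hdotxx_le (c w) _ (le w)) _.
  by rewrite rmorphM /= -rE sqnormE.
- by rewrite ell2_hdot_basis.
Qed.

Fact ell2_backshift_subproof (x : ell2 R) : (fun n => x n.+1) \in @ell2_pred R.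
Proof.
have /asboolP cx := valP x.
have h := @nondecreasing_series _ (fun n => sqmod (x n)) xpredT 0
  (fun n _ _ => sqmod_ge0 (x n)).
apply: (@ell2_mem _ (limn (series (fun n => sqmod (x n))))) => n.
apply: le_trans (nondecreasing_cvgn_le h cx n.+1).
by rewrite /series /= [leRHS]big_nat_recl //= lerDr sqmod_ge0.
Qed.

Definition ell2_backshift (x : ell2 R) : ell2 R := Ell2 (ell2_backshift_subproof x).

Lemma ell2_shift_adjoint : adjoint_pair (@ell2_shift R) ell2_backshift.
Proof.
move=> x y; rewrite -[LHS]/(ell2_dot _ _) -[RHS]/(ell2_dot _ _) /ell2_dot.
have := csum_shift (ell2_dot_summable (valP (ell2_shift x)) (valP y)).
by rewrite /= mul0r => /(_ erefl) ->.
Qed.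

Lemma ell2_shift_basis n : ell2_shift (ell2_basis n) = ell2_basis n.+1.
Proof. by apply/val_inj/funext => -[|k]. Qed.

Lemma ell2_backshift_basisS n : ell2_backshift (ell2_basis n.+1) = ell2_basis n.
Proof. by apply/val_inj/funext. Qed.

Lemma ell2_backshift_basis0 : ell2_backshift (ell2_basis 0) = 0.
Proof. by apply/val_inj/funext. Qed.

End Ell2Basis.

(** * Wandering subspaces *)

Section Wandering.
Variables (R : realType) (H : hilbertType R) (T S : H -> H).
Hypothesis TS : ppi_pair T S.
Let ST := ppi_pair_sym TS.
Let adjTS : adjoint_pair T S. Proof. by case: TS. Qed.
Let adjST : adjoint_pair S T. Proof. by case: ST. Qed.
Let adjn n : adjoint_pair (iter n T) (iter n S).
Proof. exact: adjoint_pair_iter. Qed.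

Local Notation P := (proj_ranges T).
Local Notation Q := (proj_ranges S).
Let Pp : projector P := proj_ranges_projector TS.
Let Qp : projector Q := proj_ranges_projector ST.
Let PQ x : P (Q x) = Q (P x). Proof. by rewrite (proj_ranges_commute TS). Qed.

Lemma projector_range_reducing (E : H -> H) : projector E ->
  (forall x, T (E x) = E (T x)) -> (forall x, S (E x) = E (S x)) ->
  reducing T (range E).
Proof.
move=> pE TE SE; split; first exact: projector_range_closed.
  by move=> _ [_ [x _ <-] <-]; exists (T x); rewrite ?TE.
by rewrite (adjointE adjTS) => _ [_ [x _ <-] <-]; exists (S x); rewrite ?SE.
Qed.

(** F_n m = m or F_k m' = m' removes the common power of T from both sides; if
    n <> k, this leaves m or m', which is orthogonal to the range of T because S
    kills it, against a positive power of T. *)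
Lemma iterT_orth n k m m' : S m = 0 -> S m' = 0 ->
  range_proj S T n m = m -> range_proj S T k m' = m' ->
  hdot (iter n T m) (iter k T m') = (n == k)%:R * hdot m m'.
Proof.
have SD j x y : S x = 0 -> hdot x (iter j T y) = (j == 0)%:R * hdot x y.
  move=> Sx; case: j => [|j] /=; first by rewrite mul1r.
  by rewrite -adjST Sx hdot0l mul0r.
move=> Sm Sm' Fm Fm'; case: (leqP n k) => [nk|/ltnW kn].
  rewrite -{1}(subnKC nk) iterD -(adjoint_pair_sym (adjn n)).
  by rewrite -/(range_proj S T n m) Fm SD // subn_eq0 [in RHS]eqn_leq nk.
rewrite -{1}(subnKC kn) iterD (adjn k) -/(range_proj S T k m') Fm' hdotC SD //.
by rewrite rmorphM rmorph_nat [in RHS]hdotC subn_eq0 eqn_leq kn andbT.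
Qed.

(** For the pair (T, S) these are H_s and its multiplicity space M_s; for the
    pair (S, T) they are H_b and M_b. *)
Definition shift_space : set H := range ((idfun \- P) \o Q).
Definition shift_wandering : set H := range (gap T S 0 \o Q).

Lemma shift_projector : projector ((idfun \- P) \o Q).
Proof.
apply: projector_comp => //; first exact: projector_compl.
by move=> x /=; rewrite (adjoint_pairB (proj1 Qp)) PQ.
Qed.

Lemma shift_spaceP x : shift_space x <-> P x = 0 /\ Q x = x.
Proof.
rewrite /shift_space projector_range; last exact: shift_projector.
have [[PP P2] [QQ Q2]] := (Pp, Qp).
split=> /= [<-|[Px ->]]; last by rewrite Px subr0.
rewrite (adjoint_pairB PP) P2 subrr; split=> //.
by rewrite (adjoint_pairB QQ) -PQ Q2.
Qed.

Lemma shift_wandering_projector : projector (gap T S 0 \o Q).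
Proof.
apply: projector_comp => // [|x]; first exact: gap_projector.
by rewrite /gap /= (adjoint_pairB (proj1 Qp)) !(proj_ranges_range_proj_comm ST).
Qed.

Lemma shift_wanderingP x : shift_wandering x <-> S x = 0 /\ Q x = x.
Proof.
rewrite /shift_wandering projector_range; last exact: shift_wandering_projector.
have [QQ Q2] := Qp.
split=> /= [<-|[Sx ->]].
  rewrite T_gap0 //; split=> //.
  by rewrite /gap /= (adjoint_pairB QQ) !(proj_ranges_range_proj_comm ST) !Q2.
by rewrite /gap /= /range_proj /= Sx (adjoint_pair0 adjTS) subr0.
Qed.

Lemma shift_space_T x : shift_space x -> shift_space (T x).
Proof.
move/shift_spaceP => [Px Qx]; apply/shift_spaceP.
by rewrite (proj_ranges_T TS) Px (proj_ranges_S ST) Qx (adjoint_pair0 adjTS).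
Qed.

Lemma shift_space_S x : shift_space x -> shift_space (S x).
Proof.
move/shift_spaceP => [Px Qx]; apply/shift_spaceP.
by rewrite (proj_ranges_S TS) Px (proj_ranges_T ST) Qx (adjoint_pair0 adjST).
Qed.

Lemma shift_space_iter n m : shift_wandering m -> shift_space (iter n T m).
Proof.
move/shift_wanderingP => [Sm Qm].
elim: n => [|n IH]; last exact: shift_space_T.
apply/shift_spaceP; split=> //; rewrite -(proj_ranges_range_proj TS 1) /range_proj /= Sm.
by rewrite (adjoint_pair0 adjTS) (adjoint_pair0 (proj1 Pp)).
Qed.

Lemma shift_orth n k m m' : shift_wandering m -> shift_wandering m' ->
  hdot (iter n T m) (iter k T m') = (n == k)%:R * hdot m m'.
Proof.
move=> /shift_wanderingP[Sm Qm] /shift_wanderingP[Sm' Qm'].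
by apply: iterT_orth => //; apply: (proj1 (proj_ranges_fix ST _)).
Qed.

(** With g = E_0 - E_1, the vector g S^n w belongs to the wandering subspace and
    <w, T^n g S^n w> = |g S^n w|^2, so g S^n w = 0; applying T^n turns this into
    E_n w = E_(n+1) w. Hence all E_n fix w, and w = P w = 0. *)
Lemma shift_total w : shift_space w ->
  (forall n m, shift_wandering m -> hdot w (iter n T m) = 0) -> w = 0.
Proof.
move=> /shift_spaceP[Pw Qw] wo.
have [[PP _] [QQ _]] := (Pp, Qp).
rewrite -Pw; apply/esym/(proj_ranges_fix TS); elim=> [//|n IH].
rewrite -[RHS]IH; have [GG G2] := gap_projector TS 0.
set u := iter n S w; have Qu : Q u = u.
  rewrite /u; elim: (n) => [//|k IHk] /=.
  by rewrite (proj_ranges_T ST) IHk.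
have /subr0_eq uE : gap T S 0 u = 0.
  apply: hdot_eq0; rewrite GG G2 (adjoint_pair_sym (adjn n)); apply: wo.
  by exists u => //=; rewrite Qu.
by rewrite /range_proj iterSr; congr (iter n T _); exact/esym.
Qed.
End Wandering.

Section TruncatedModel.
Variables (R : realType) (H : hilbertType R) (T S : H -> H).
Hypothesis TS : ppi_pair T S.
Let ST := ppi_pair_sym TS.
Let adjTS : adjoint_pair T S. Proof. by case: TS. Qed.
Let adjn n : adjoint_pair (iter n T) (iter n S).
Proof. exact: adjoint_pair_iter. Qed.

Lemma iterT_corner n a b x :
  iter n T (corner T S a (n + b) x) = corner T S (a + n) b (iter n T x).
Proof.
elim: n a b x => [|n IH] a b x; first by rewrite addn0.
by rewrite iterSr addSn T_corner // IH addSnnS -iterSr.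
Qed.

Lemma corner_wandering k m : range (corner T S 0 k) m ->
  S m = 0 /\ forall n, (n <= k)%N -> range_proj S T n m = m.
Proof.
move=> [x _ <-]; split; first by rewrite /corner /= T_gap0.
by move=> n nk; rewrite corner_swap // /corner /= range_proj_gap.
Qed.

Lemma iterT_corner_space k n m : range (corner T S 0 k) m ->
  range (antidiag T S k) (iter n T m).
Proof.
have [DD _] := antidiag_projector TS k.
have [CC _] := corner_projector TS 0 k.
have D_iter y : antidiag T S k (iter n T y) = iter n T (antidiag T S k y).
  by elim: n => [//|n IH] /=; rewrite -T_antidiag // IH.
move=> [x _ <-]; exists (iter n T (corner T S 0 k x)) => //.
rewrite D_iter; congr (iter n T _).
apply: hdot_inj => z; rewrite DD CC -[k in antidiag _ _ k]add0n.
by rewrite corner_antidiag // -CC.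
Qed.

Lemma corner_orth k n l m m' : (n <= k)%N -> (l <= k)%N ->
  range (corner T S 0 k) m -> range (corner T S 0 k) m' ->
  hdot (iter n T m) (iter l T m') = (n == l)%:R * hdot m m'.
Proof.
move=> nk lk /corner_wandering[Sm Fm] /corner_wandering[Sm' Fm'].
by apply: (iterT_orth TS) => //; [apply: Fm|apply: Fm'].
Qed.

(** As in [shift_total], R_(0,k) S^n w = 0 for n <= k. Applying T^n gives
    R_(n,k-n) E_n w = R_(n,k-n) w = 0, so every corner of the antidiagonal
    vanishes on w. *)
Lemma corner_total k w : range (antidiag T S k) w ->
  (forall n m, (n <= k)%N -> range (corner T S 0 k) m ->
     hdot w (iter n T m) = 0) -> w = 0.
Proof.
rewrite projector_range => [/= <- wo|]; last exact: antidiag_projector.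
move: (antidiag T S k w) wo (proj2 (antidiag_projector TS k) w) => {}w wo <-.
apply: antidiag_eq0 => n nk.
have [CC C2] := corner_projector TS 0 k.
have c0 : corner T S 0 k (iter n S w) = 0.
  apply: hdot_eq0; rewrite CC C2 (adjoint_pair_sym (adjn n)).
  by apply: wo => //; exists (iter n S w).
have := iterT_corner n 0 (k - n) (iter n S w).
rewrite subnKC // c0 (adjoint_pair0 (adjn n)) add0n -/(range_proj T S n w).
rewrite corner_swap // /corner /= => h.
rewrite gap_comm //; move/esym: h; congr (_ = _); congr gap.
have [EE _] := range_proj_projector TS n.
have [GG _] := gap_projector TS n.
by apply: hdot_inj => z; rewrite GG EE range_proj_gap // -GG.
Qed.

Lemma T_corner_top k m : range (corner T S 0 k) m -> T (iter k T m) = 0.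
Proof.
move=> [x _ <-]; rewrite -{2}[k]addn0 iterT_corner T_corner0 //.
Qed.

End TruncatedModel.

(** * The decomposition *)

Section Decomposition.
Variables (R : realType) (H : hilbertType R) (T S : H -> H).
Hypothesis TS : ppi_pair T S.
Let ST := ppi_pair_sym TS.
Local Notation P := (proj_ranges T).
Local Notation Q := (proj_ranges S).
Let Pp : projector P := proj_ranges_projector TS.
Let Qp : projector Q := proj_ranges_projector ST.
Let QP x : Q (P x) = P (Q x). Proof. exact: (proj_ranges_commute TS). Qed.

Definition summand_projector (i : summand) : H -> H :=
  match i with
  | Unitary => P \o Q
  | Forward => (idfun \- P) \o Q
  | Backward => (idfun \- Q) \o P
  | Truncated k => antidiag T S k
  end.

Lemma summand_projectorP i : projector (summand_projector i).
Proof.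
case: i => [|||k] /=; [|exact: shift_projector..|exact: antidiag_projector].
by apply: projector_comp => // x; rewrite QP.
Qed.

(** Distinct antidiagonals share no corner. The other cases follow from P and Q
    being commuting projections and from the vanishing of every product of an
    antidiagonal sum with P or Q. *)
Lemma summand_projector_orth i j x : i <> j ->
  summand_projector i (summand_projector j x) = 0.
Proof.
have [[PP P2] [QQ Q2]] := (Pp, Qp).
have DP k y : antidiag T S k (P y) = 0.
  by rewrite antidiag_eq0 // => a _; rewrite corner_proj_ranges.
have DQ k y : antidiag T S k (Q y) = 0.
  by rewrite antidiag_eq0 // => a _; rewrite corner_proj_ranges2.
have PD k y : P (antidiag T S k y) = 0.
  have [DD _] := antidiag_projector TS k.
  by apply: hdot_inj => z; rewrite PP DD DP hdot0r hdot0l.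
have QD k y : Q (antidiag T S k y) = 0.
  have [DD _] := antidiag_projector TS k.
  by apply: hdot_inj => z; rewrite QQ DD DQ hdot0r hdot0l.
have P0 : P 0 = 0 := adjoint_pair0 PP.
have Q0 : Q 0 = 0 := adjoint_pair0 QQ.
have DB k y z : antidiag T S k (y - z) = antidiag T S k y - antidiag T S k z.
  by have [DD _] := antidiag_projector TS k; rewrite (adjoint_pairB DD).
case: i j => [|||k] [|||l] // ij;
  rewrite /= ?(DB, adjoint_pairB PP, adjoint_pairB QQ, P2, Q2, QP, DP, DQ,
               PD, QD, P0, Q0, subrr) //.
by apply: antidiag_antidiag0 => //; apply/eqP => kl; apply: ij; rewrite kl.
Qed.

Lemma summand_projector_total x : (forall i, summand_projector i x = 0) -> x = 0.
Proof.
move=> x0; have := x0 Unitary; have := x0 Forward; have := x0 Backward.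
rewrite /= QP => hb hs hu; rewrite hu subr0 in hb; rewrite hu subr0 in hs.
apply: (decomposition_total TS) => [||k]; [exact: hb|exact: hs|].
exact: (x0 (Truncated k)).
Qed.

Lemma orth_direct_sum_range :
  orth_direct_sum (fun i => range (summand_projector i)).
Proof.
split=> [i|i j ij _ _ [x _ <-] [y _ <-]|].
- exact/projector_range_closed/summand_projectorP.
- have [EE _] := summand_projectorP i.
  by rewrite EE summand_projector_orth // hdot0r.
- apply: closed_span_eqT => x xo; apply: summand_projector_total => i.
  have [EE E2] := summand_projectorP i.
  by apply: hdot_eq0; rewrite EE E2; apply: xo; exists i => //; exists x.
Qed.

Lemma summand_projector_T i x :
  T (summand_projector i x) = summand_projector i (T x).
Proof.
have [adjTS _] := TS.
case: i => [|||k] /=; last exact: T_antidiag.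
all: by rewrite ?(adjoint_pairB adjTS) -?(proj_ranges_T TS, proj_ranges_S ST).
Qed.

Lemma summand_projector_S i x :
  S (summand_projector i x) = summand_projector i (S x).
Proof.
have [adjST _] := ST.
case: i => [|||k] /=; last exact: S_antidiag.
all: by rewrite ?(adjoint_pairB adjST) -?(proj_ranges_S TS, proj_ranges_T ST).
Qed.

Lemma summand_reducing i : reducing T (range (summand_projector i)).
Proof.
apply: (projector_range_reducing TS); first exact: summand_projectorP.
  exact: summand_projector_T.
exact: summand_projector_S.
Qed.

Lemma unitary_summand :
  unitary_between T (range (P \o Q)) (range (P \o Q)).
Proof.
have [adjTS _] := TS; have adjST := adjoint_pair_sym adjTS.
split=> [_ y [x _ <-] _|].
  rewrite -adjST -[S (T _)]/(range_proj S T 1 _) /=.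
  by rewrite -QP (range_proj_proj_ranges ST).
apply/seteqP; split=> [_ [_ [x _ <-] <-]|_ [x _ <-]].
  by exists (T x) => //=; exact/esym/(summand_projector_T Unitary).
exists (P (Q (S x))); first by exists (S x).
rewrite -[P _]/(summand_projector Unitary (S x)) -summand_projector_S /=.
exact: (range_proj_proj_ranges TS 1).
Qed.

Lemma H_p_range k : adjoint T = S -> H_p T k.+1 = range (antidiag T S k).
Proof.
move=> TE; rewrite (antidiag_range TS).
have fE n : final_proj T n = range_proj T S n by rewrite -TE.
have iE n : initial_proj T n = range_proj S T n by rewrite -TE.
have sumE (h : nat -> H) : \sum_(1 <= n < k.+2)
    (final_proj T (n - 1) \- final_proj T n)
      ((initial_proj T (k.+1 - n) \- initial_proj T (k.+1 - n + 1)) (h n)) =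
    \sum_(a < k.+1) corner T S a (k - a) (h a.+1).
  rewrite big_add1 big_mkord; apply: eq_bigr => a _.
  by rewrite !fE !iE !subSS subn0 addn1.
apply/seteqP; split=> [_ [h ->]|_ [h ->]].
  by exists (fun a => h a.+1); exact: sumE.
by exists (fun n => h n.-1); rewrite [RHS]sumE.
Qed.

Hypothesis Tb : bounded_op T.

Lemma forward_summand :
  unitarily_equivalent_to_tensor
    (sub_hilbert (projector_range_closed (shift_wandering_projector TS)))
    T (shift_space T S) (@ell2_shift R).
Proof.
have [adjTS _] := TS.
refine (@restricted_tensor_model _ _ _ _ (ell2_basisP R) _ T S _ _ adjTS Tb _ _ _ _
  (fun n => iter n T) (fun n => iter n S) _ _ _ _ _ _ (@ell2_shift_adjoint R) _).
- exact/projector_range_closed/shift_projector.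
- exact: shift_space_T.
- exact: shift_space_S.
- by move=> n; exact: adjoint_pair_iter.
- by move=> n m; exact: shift_space_iter.
- by move=> n k m m'; exact: shift_orth.
- by move=> w Kw wo; apply: (shift_total TS Kw).
- by move=> n; left; exists n.+1; split; first exact: ell2_shift_basis.
Qed.

Lemma backward_summand :
  unitarily_equivalent_to_tensor
    (sub_hilbert (projector_range_closed (shift_wandering_projector ST)))
    T (shift_space S T) (adjoint (@ell2_shift R)).
Proof.
have [adjTS TST] := TS.
rewrite (adjointE (@ell2_shift_adjoint R)).
apply: (@restricted_tensor_model _ _ _ _ (ell2_basisP R) _ T S _ _ adjTS Tb _ _ _ _
  (fun n => iter n S) (fun n => iter n T) _ _ _ _ _ _
  (adjoint_pair_sym (@ell2_shift_adjoint R))).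
- exact/projector_range_closed/shift_projector.
- exact: shift_space_S.
- exact: shift_space_T.
- by move=> n; apply: adjoint_pair_iter; exact: adjoint_pair_sym.
- by move=> n m; exact: shift_space_iter.
- by move=> n k m m'; exact: shift_orth.
- by move=> w Kw wo; apply: (shift_total ST Kw).
case=> [|n]; [right|left].
  split; first exact: ell2_backshift_basis0.
  by move=> m /(shift_wanderingP ST)[].
exists n; split=> [|m Nm]; first exact: ell2_backshift_basisS.
have /(shift_spaceP ST)[_ Pm] := shift_space_iter ST n Nm.
rewrite iterS -[T (S _)]/(range_proj T S 1 _).
by apply: (proj1 (proj_ranges_fix TS _)).
Qed.

Lemma truncated_summand k :
  unitarily_equivalent_to_tensor
    (sub_hilbert (projector_range_closed (corner_projector TS 0 k)))
    T (range (antidiag T S k)) (@truncated_shift R k.+1).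
Proof.
have [adjTS _] := TS.
have [Kc TK SK] := summand_reducing (Truncated k).
rewrite (adjointE adjTS) in SK.
apply: (@restricted_tensor_model _ _ _ _ (@cvec_basisP R k.+1) _ T S _ _ adjTS Tb Kc
  _ _ _ (fun n : 'I_k.+1 => iter n T) (fun n => iter n S) _ _ _ _ _ _
  (@truncated_shift_adjoint R k.+1)).
- by move=> x Kx; apply: TK; exists x.
- by move=> x Kx; apply: SK; exists x.
- by move=> n; exact: adjoint_pair_iter.
- by move=> n m; exact: iterT_corner_space.
- move=> n l m m' Nm Nm'.
  by rewrite (corner_orth TS _ _ Nm Nm') // -ltnS.
- move=> w Kw wo; apply: (corner_total TS Kw) => n m nk Nm.
  exact: (wo (Ordinal (nk : (n < k.+1)%N)) m Nm).
move=> i; have [bS b0] := truncated_shift_basis R i.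
have [ik|ik] := ltnP i k; [left|right].
  have j_lt : (i.+1 < k.+1)%N by [].
  by exists (Ordinal j_lt); split=> //; exact: bS.
have {}ik : i = k :> nat by apply/eqP; rewrite eqn_leq ik -ltnS ltn_ord.
split=> [|m Nm]; first by apply: b0; rewrite ik.
by rewrite ik (T_corner_top TS Nm).
Qed.

End Decomposition.

Theorem theorem2p1 (R : realType) (H : hilbertType R) (T : {linear H -> H})
    (T_bounded : bounded_op T) (T_ppi : power_partial_isometry T) :
  let P := proj_ranges T in
  let Q := proj_adjoint_ranges T in
  P \o Q = Q \o P /\
  [/\ reducing T (H_u T), reducing T (H_s T), reducing T (H_b T) &
      forall p, (1 <= p)%N -> reducing T (H_p T p)] /\
  orth_direct_sum (summand_space T) /\
  exists (Ms Mb : hilbertType R) (Mp : nat -> hilbertType R),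
    [/\ unitary_between T (H_u T) (H_u T),
        unitarily_equivalent_to_tensor Ms T (H_s T) (@ell2_shift R),
        unitarily_equivalent_to_tensor Mb T (H_b T) (adjoint (@ell2_shift R)) &
        forall p, (1 <= p)%N ->
          unitarily_equivalent_to_tensor (Mp p) T (H_p T p)
            (@truncated_shift R p)].
Proof.
set S := adjoint T.
have adjTS : adjoint_pair T S.
  by have [M TM] := T_bounded; exact: adjoint_pairP (linearP T) TM.
have TS : ppi_pair T S.
  split=> // n x; apply: partial_isometry_adj; first exact: adjoint_pair_iter.
  exact: T_ppi.
have HpE k : H_p T k.+1 = range (antidiag T S k) by exact: H_p_range.
have spaceE i : summand_space T i = range (summand_projector T S i).
  by case: i => [|||k] //=; exact: HpE.
have red i : reducing T (summand_space T i).
  by rewrite spaceE; exact: summand_reducing.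
move=> P Q; split; first by apply/funext => x; exact/esym/(proj_ranges_commute TS).
split.
  split; [exact: (red Unitary)|exact: (red Forward)|exact: (red Backward)|].
  by case=> [//|k] _; exact: (red (Truncated k)).
split.
  rewrite (_ : summand_space T = fun i => range (summand_projector T S i)).
    exact: orth_direct_sum_range.
  exact/funext.
exists (sub_hilbert (projector_range_closed (shift_wandering_projector TS))).
exists (sub_hilbert (projector_range_closed
  (shift_wandering_projector (ppi_pair_sym TS)))).
exists (fun p => sub_hilbert (projector_range_closed (corner_projector TS 0 p.-1))).
split.
- exact: unitary_summand.
- exact: forward_summand.
- exact: backward_summand.
- by case=> [//|k] _; rewrite HpE; exact: truncated_summand.
Qed.
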